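(* Let $f:\mathbb{R}^m\to\mathbb{R}$ satisfy Assumption A in the context with $q$-th order Hölder continuous Hessian for some $q\in(0,1]$, let $\{x_k\}$ be generated by Algorithm 1 described in the context, and let the set $\mathcal{L}(f(x_{k_0}))=\{y:f(y)\le f(x_{k_0})\}$ be bounded for some $k_0\in\mathbb{N}$. Let $\Theta=\{x:\nabla f(x)=0,\ \nabla^2f(x)\succeq0\}$, let $\overline{x}$ be an accumulation point of $\{x_k\}$, let $p>0$, and suppose that there exist $c,\eta>0$ such that $$d(x,\Theta)^p\le c\,\|\nabla f(x)\|\quad\text{for all } x\text{ with }\|x-\overline{x}\|<\eta.$$ If $p<q+1$, then $\{x_k\}$ converges at least superlinearly to $\overline{x}\in\Theta$ as $k\to\infty$ with the rate $\frac{q+1}{p}$, i.e., $$\limsup_{k\to\infty}\frac{\|x_k-\overline{x}\|}{\|x_{k-1}-\overline{x}\|^{\frac{q+1}{p}}}<\infty.$$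
   Context: $\mathbb{N}=\{0,1,\ldots\}$; $d(x,S)$ is the Euclidean distance. Assumption A. (1) $f$ is $C^2$-smooth and $f^*:=\inf_{x\in\mathbb{R}^m}f(x)>-\infty$. (2) There is a closed convex set $\mathcal{F}\subset\mathbb{R}^m$ with nonempty interior such that $\{y:f(y)\le f(x_0)\}\subset\mathrm{int}(\mathcal{F})$, where $x_0\in\mathrm{int}(\mathcal{F})$ is the starting point. (3) $\nabla f$ is Lipschitz continuous with modulus $L_1>0$ on $\mathcal{F}$, and $\|\nabla^2f(x)-\nabla^2f(y)\|\le L_2\|x-y\|^q$ for all $x,y\in\mathcal{F}$, with $L_2>0$ and $q\in(0,1]$. For $\sigma>0$ let $f_\sigma(y;x):=f(x)+\langle\nabla f(x),y-x\rangle+\frac12\langle\nabla^2f(x)(y-x),y-x\rangle+\frac{\sigma}{(q+1)(q+2)}\|y-x\|^{q+2}$. Algorithm 1. Input: $x_0=\widehat x_0\in\mathbb{R}^m$, scalars $\overline{\sigma}\in\left(\frac{2L_2}{q+2},L_2\right]$ and $\zeta\in[0,1)$. For $k=0,1,\ldots$: (a) choose $\sigma_k\in[\overline{\sigma},2L_2]$ and find $\widehat x_{k+1}\in\arg\min_{y\in\mathbb{R}^m}f_{\sigma_k}(y;x_k)$; (b) set $\beta_{k+1}=\min\{\zeta,\|\nabla f(\widehat x_{k+1})\|,\|\widehat x_{k+1}-x_k\|\}$ and $\widetilde x_{k+1}=\widehat x_{k+1}+\beta_{k+1}(\widehat x_{k+1}-\widehat x_k)$; (c) let $x_{k+1}$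 be a minimizer of $f$ over the two-point set $\{\widehat x_{k+1},\widetilde x_{k+1}\}$. *)

(* Defs.v *)
From HB Require Import structures.
From mathcomp Require Export all_boot all_order all_algebra.
From mathcomp Require Export all_classical all_reals all_analysis.
Export Order.TTheory GRing.Theory Num.Theory.
Export numFieldNormedType.Exports.

Set Implicit Arguments.
Unset Strict Implicit.
Unset Printing Implicit Defensive.

Local Open Scope classical_set_scope.
Local Open Scope ring_scope.

(* Points of R^m are row vectors. The norm `|_| that the library puts on
   'rV[R]_m is the max norm: it is only used below through the topology
   (differentiability, convergence, closed, interior, bounded), while all
   metric estimates use the Euclidean norm [enorm]. *)

Section Euclidean.
Context {R : realType} {m : nat}.
Implicit Types (u v : 'rV[R]_m) (A : 'M[R]_m) (S : set 'rV[R]_m).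

Definition dot u v : R := \sum_(i < m) u 0 i * v 0 i.

Definition enorm u : R := Num.sqrt (dot u u).

(* Operator norm subordinate to the Euclidean norm. *)
Definition opnorm A : R :=
  sup [set enorm (v *m A) | v in [set v | enorm v <= 1]].

Definition psd A : Prop := forall v, 0 <= dot (v *m A) v.

(* Extended-real valued, so that the distance to the empty set is +oo. *)
Definition edistance u S : \bar R :=
  ereal_inf [set (enorm (u - v))%:E | v in S].

End Euclidean.

Section Calculus.
Context {R : realType} {m : nat}.
Implicit Types (f : 'rV[R]_m -> R) (x : 'rV[R]_m).

Definition grad f x : 'rV[R]_m := \row_(i < m) 'D_(delta_mx 0 i) f x.

(* The (i, j) entry is the i-th partial derivative of the j-th partial
   derivative of f; the matrix acts on row vectors from the right. *)
Definition hess f x : 'M[R]_m := 'J (grad f) x.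

Definition C2 f : Prop :=
  [/\ forall x, differentiable f x,
      forall x, differentiable (grad f) x
    & continuous (hess f)].

Definition sublevel f (a : R) : set 'rV[R]_m := [set y | f y <= a].

(* The set Theta of second-order stationary points. *)
Definition stationary2 f : set 'rV[R]_m :=
  [set x | grad f x = 0 /\ psd (hess f x)].

Definition argmin f (S : set 'rV[R]_m) : set 'rV[R]_m :=
  [set y | S y /\ forall z, S z -> f y <= f z].

End Calculus.

Section CubicNewton.
Context {R : realType} {m : nat}.
Implicit Types (f : 'rV[R]_m -> R) (x y : 'rV[R]_m).

Definition assumptionA f (x0 : 'rV[R]_m) (L1 L2 q : R) : Prop :=
  [/\ C2 f,
      (-oo < ereal_inf [set (f x)%:E | x in [set: 'rV[R]_m]])%E,
      0 < L1,
      (0 < L2) /\ (0 < q <= 1)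
    & exists F : set 'rV[R]_m,
      [/\ [/\ closed F,
              convex_set (F : set (convex_lmodType 'rV[R]_m))
            & F° !=set0],
          F° x0,
          sublevel f (f x0) `<=` F°,
          forall x y, F x -> F y ->
            enorm (grad f x - grad f y) <= L1 * enorm (x - y)
        & forall x y, F x -> F y ->
            opnorm (hess f x - hess f y) <= L2 * enorm (x - y) `^ q]].

(* [model f q sigma x y] is f_sigma(y; x). *)
Definition model f (q sigma : R) x y : R :=
  f x + dot (grad f x) (y - x)
  + 2^-1 * dot ((y - x) *m hess f x) (y - x)
  + sigma / ((q + 1) * (q + 2)) * enorm (y - x) `^ (q + 2).

Record algorithm1 f (L2 q sigmabar zeta : R) (sigma : nat -> R)
    (x xhat : nat -> 'rV[R]_m) : Prop := Algorithm1 {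
  alg_sigmabar : 2 * L2 / (q + 2) < sigmabar <= L2 ;
  alg_zeta : 0 <= zeta < 1 ;
  alg_init : x 0%N = xhat 0%N ;
  alg_sigma : forall k, sigmabar <= sigma k <= 2 * L2 ;
  alg_newton : forall k,
    argmin (model f q (sigma k) (x k)) setT (xhat k.+1) ;
  alg_select : forall k,
    let beta := Num.min zeta
      (Num.min (enorm (grad f (xhat k.+1))) (enorm (xhat k.+1 - x k))) in
    let xtilde := xhat k.+1 + beta *: (xhat k.+1 - xhat k) in
    argmin f [set xhat k.+1; xtilde] (x k.+1)
}.

End CubicNewton.

(* Main.v *)
Require Import Defs.
From mathcomp Require Import ring lra.

Set Implicit Arguments.
Unset Strict Implicit.
Unset Printing Implicit Defensive.

Local Open Scope classical_set_scope.
Local Open Scope ring_scope.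

(** The proof compares two estimates of the step s_k = xhat_(k+1) - x_k, and
    writes r_k for its length.

    Descent. Minimality of the model gives a first-order condition
    (model_first_order) and the global second-order condition
    H(x_k) + sigma_k / (q + 1) r_k^q I >= 0 (model_second_order). Together with
    the Taylor bounds for a Hoelder Hessian they yield
    f(xhat_(k+1)) <= f(x_k) - kappa r_k^(q + 2) with kappa > 0
    (step_decrease); the same estimate at every point of the segment shows that
    the step never leaves the set F on which the smoothness assumptions hold
    (step_inF). Since f is bounded below, r_k tends to 0. The first-order
    condition also gives |grad f(xhat_(k+1))| = O(r_k^(q + 1)) (step_grad), and
    this survives the extrapolation, whose weight is at most
    |grad f(xhat_(k+1))| and at most r_k while the extrapolation direction is
    bounded because a sublevel set is: |grad f(x_(k+1))| = O(r_k^(q + 1)) and |x_(k+1) - x_k| = O(r_k).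
    Hence every accumulation point is second-order stationary.

    Local rate. Near a point of Theta the step is not longer than a constant
    times the distance d_k from x_k to Theta (step_le_dist). Combined with the
    error bound,
    d_(k+1)^p <= c |grad f(x_(k+1))| = O(r_k^(q + 1)) = O(d_k^(q + 1)),
    so that d_(k+1) = O(d_k^alpha) with alpha = (q + 1) / p > 1, whereas
    |x_(k+1) - x_k| = O(d_k). Once an iterate is close enough to xbar, the
    distances d_k at least halve at every step and the total length of the
    remaining path is O(d_k) (trapped). This gives convergence to xbar
    (local_convergence), and also
    |x_(k+1) - xbar| = O(d_(k+1)) = O(d_k^alpha) = O(|x_k - xbar|^alpha)
    (local_rate). *)

(** * Euclidean norm and operator norm *)

Section EuclideanFacts.
Context {R : realType} {m : nat}.
Implicit Types (u v w : 'rV[R]_m) (A B : 'M[R]_m) (a : R).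

Lemma dotC u v : dot u v = dot v u.
Proof. by apply: eq_bigr => i _; rewrite mulrC. Qed.

Lemma dotDl u v w : dot (u + v) w = dot u w + dot v w.
Proof. by rewrite /dot -big_split; apply: eq_bigr => i _; rewrite mxE mulrDl. Qed.

Lemma dotZl a u v : dot (a *: u) v = a * dot u v.
Proof. by rewrite /dot mulr_sumr; apply: eq_bigr => i _; rewrite mxE mulrA. Qed.

Lemma dotDr u v w : dot u (v + w) = dot u v + dot u w.
Proof. by rewrite dotC dotDl !(dotC _ u). Qed.

Lemma dotZr a u v : dot u (a *: v) = a * dot u v.
Proof. by rewrite dotC dotZl dotC. Qed.

Lemma dotNl u v : dot (- u) v = - dot u v.
Proof. by rewrite -scaleN1r dotZl mulN1r. Qed.

Lemma dotNr u v : dot u (- v) = - dot u v.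
Proof. by rewrite dotC dotNl dotC. Qed.

Lemma dotBl u v w : dot (u - v) w = dot u w - dot v w.
Proof. by rewrite dotDl dotNl. Qed.

Lemma dotBr u v w : dot u (v - w) = dot u v - dot u w.
Proof. by rewrite dotDr dotNr. Qed.

Lemma dot0l u : dot 0 u = 0.
Proof. by rewrite -(scale0r u) dotZl mul0r. Qed.

Lemma dot0r u : dot u 0 = 0.
Proof. by rewrite dotC dot0l. Qed.

Lemma dot_ge0 u : 0 <= dot u u.
Proof. by apply: sumr_ge0 => i _; rewrite -expr2 sqr_ge0. Qed.

Lemma enorm_ge0 u : 0 <= enorm u.
Proof. exact: sqrtr_ge0. Qed.

Lemma enorm_sqr u : enorm u ^+ 2 = dot u u.
Proof. by rewrite sqr_sqrtr// dot_ge0. Qed.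

Lemma dotvv u : dot u u = enorm u * enorm u.
Proof. by rewrite -enorm_sqr expr2. Qed.

Lemma enorm0 : enorm (0 : 'rV[R]_m) = 0.
Proof. by rewrite /enorm dot0l sqrtr0. Qed.

Lemma enorm_eq0 u : enorm u = 0 -> u = 0.
Proof.
move=> u0; apply/rowP => i; rewrite mxE.
have /eqP : dot u u = 0 by rewrite dotvv u0 mul0r.
rewrite psumr_eq0; last by move=> j _; rewrite -expr2 sqr_ge0.
by move/allP/(_ i (mem_index_enum _)); rewrite /= mulf_eq0 orbb => /eqP.
Qed.

Lemma enorm_gt0 u : u != 0 -> 0 < enorm u.
Proof.
by move=> u0; rewrite lt_def enorm_ge0 andbT; apply: contra_neq u0 => /enorm_eq0.
Qed.

Lemma enormZ a u : enorm (a *: u) = `|a| * enorm u.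
Proof.
by rewrite /enorm dotZl dotZr mulrA -expr2 sqrtrM ?sqr_ge0// sqrtr_sqr.
Qed.

Lemma enormN u : enorm (- u) = enorm u.
Proof. by rewrite -scaleN1r enormZ normrN1 mul1r. Qed.

Lemma enormB u v : enorm (u - v) = enorm (v - u).
Proof. by rewrite -enormN opprB. Qed.

Lemma cauchy_schwarz u v : dot u v <= enorm u * enorm v.
Proof.
have [->|/enorm_gt0 u0] := eqVneq u 0; first by rewrite dot0l enorm0 mul0r.
have [->|/enorm_gt0 v0] := eqVneq v 0; first by rewrite dot0r enorm0 mulr0.
have := dot_ge0 (enorm v *: u - enorm u *: v).
rewrite dotBl !dotBr !dotZl !dotZr (dotC v u) !dotvv => h.
by rewrite -subr_ge0 -(pmulr_rge0 _ u0) -(pmulr_rge0 _ v0); nra.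
Qed.

Lemma cauchy_schwarzN u v : - (enorm u * enorm v) <= dot u v.
Proof. by rewrite lerNl -dotNl -(enormN u) cauchy_schwarz. Qed.

Lemma enormD u v : enorm (u + v) <= enorm u + enorm v.
Proof.
rewrite -(@ler_pXn2r _ 2) ?nnegrE ?addr_ge0 ?enorm_ge0//.
rewrite enorm_sqr dotDl !dotDr (dotC v u) !dotvv.
have := cauchy_schwarz u v; lra.
Qed.

(** Testing a vector against itself turns bounds on inner products into a bound
    on the norm. *)
Lemma enorm_le_dot u a : 0 <= a -> dot u u <= a * enorm u -> enorm u <= a.
Proof.
move=> a0; rewrite dotvv; have := enorm_ge0 u; rewrite le_eqVlt => /predU1P[<-//|u0].
by rewrite ler_pM2r.
Qed.

Lemma coord_le_enorm u i : `|u 0 i| <= enorm u.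
Proof.
rewrite -(@ler_pXn2r _ 2) ?nnegrE ?enorm_ge0// enorm_sqr real_normK ?num_real//.
rewrite /dot (bigD1 i)//= -expr2 lerDl sumr_ge0// => j _.
by rewrite -expr2 sqr_ge0.
Qed.

Lemma norm_le_enorm u : `|u| <= enorm u.
Proof.
rewrite [leLHS]/Num.Def.normr/= mx_normrE; apply/bigmax_leP.
split; first exact: enorm_ge0.
by move=> [i j] _ /=; rewrite ord1 coord_le_enorm.
Qed.

Lemma coord_le_norm u i : `|u 0 i| <= `|u|.
Proof.
by rewrite [leRHS]/Num.Def.normr/= mx_normrE; apply/bigmax_geP; right; exists (0, i).
Qed.

Lemma enorm_le_norm u : enorm u <= m%:R * `|u|.
Proof.
rewrite -(@ler_pXn2r _ 2) ?nnegrE ?mulr_ge0 ?enorm_ge0//.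
rewrite enorm_sqr exprMn; apply: (@le_trans _ _ (\sum_(i < m) `|u| ^+ 2)).
  apply: ler_sum => i _; rewrite -expr2 -(real_normK (num_real _)).
  by rewrite ler_pXn2r ?nnegrE// coord_le_norm.
rewrite sumr_const card_ord -[_ *+ m]mulr_natl ler_wpM2r ?sqr_ge0//.
by rewrite -natrX ler_nat; case: (m) => // n; rewrite leq_pmulr.
Qed.

(** This makes the set whose supremum is the operator norm bounded above. *)
Lemma enorm_mulmx_frobenius v A :
  enorm (v *m A) <= enorm v * Num.sqrt (\sum_j dot (col j A)^T (col j A)^T).
Proof.
have S0 : 0 <= \sum_j dot (col j A)^T (col j A)^T.
  by apply: sumr_ge0 => j _; exact: dot_ge0.
rewrite -(@ler_pXn2r _ 2) ?nnegrE ?mulr_ge0 ?enorm_ge0 ?sqrtr_ge0//.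
rewrite exprMn (sqr_sqrtr S0) (enorm_sqr (v *m A)) mulr_sumr; apply: ler_sum => j _.
have -> : (v *m A) 0 j = dot v (col j A)^T.
  by rewrite mxE; apply: eq_bigr => i _; rewrite !mxE.
rewrite -expr2 -enorm_sqr -exprMn -(real_normK (num_real _)).
rewrite ler_pXn2r ?nnegrE ?mulr_ge0 ?enorm_ge0// ler_norml.
by rewrite cauchy_schwarz cauchy_schwarzN.
Qed.

Lemma opnorm_ub v A : enorm (v *m A) <= opnorm A * enorm v.
Proof.
set S := [set enorm (v *m A) | v in [set v | enorm v <= 1]].
have Sub : has_ubound S.
  exists (Num.sqrt (\sum_j dot (col j A)^T (col j A)^T)) => _ [w /= w1 <-].
  apply: le_trans (enorm_mulmx_frobenius w A) _.
  by rewrite ler_piMl ?sqrtr_ge0.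
have [->|/enorm_gt0 v0] := eqVneq v 0; first by rewrite mul0mx !enorm0 mulr0.
rewrite -ler_pdivrMr// /opnorm; apply: (ub_le_sup Sub).
have vi : `|(enorm v)^-1| = (enorm v)^-1 by rewrite ger0_norm// invr_ge0 enorm_ge0.
exists ((enorm v)^-1 *: v) => /=.
  by rewrite enormZ vi mulVf// gt_eqF.
by rewrite -scalemxAl enormZ vi mulrC.
Qed.

Lemma dot_mulmx_le u v A : dot (u *m A) v <= opnorm A * enorm u * enorm v.
Proof.
apply: le_trans (cauchy_schwarz _ _) _.
by rewrite ler_wpM2r ?enorm_ge0// opnorm_ub.
Qed.

End EuclideanFacts.

(** * Inequalities between real powers *)

Section Powers.
Context {R : realType}.
Implicit Types (a b q t A B : R).

Lemma powRS a b : 0 <= a -> 0 < b -> a `^ (b + 1) = a `^ b * a.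
Proof.
move=> a0 b0; rewrite powRD ?powRr1//.
by apply/implyP => /eqP; lra.
Qed.

Lemma powRD2 a q : 0 <= a -> 0 < q -> a `^ (q + 2) = a `^ q * a ^+ 2.
Proof.
move=> a0 q0; rewrite [q + 2](_ : _ = q + 1 + 1); last by lra.
rewrite !powRS ?expr2 ?mulrA//; lra.
Qed.

(** This is Young's inequality with exponents (q + 2) / q and (q + 2) / 2; it
    says that the power (q + 2) / 2, as a function of the squared norm, lies
    above its tangents. *)
Lemma powRD2_tangent a b q : 0 <= a -> 0 <= b -> 0 < q ->
  a `^ (q + 2) - b `^ (q + 2) <= (q + 2) / 2 * a `^ q * (a ^+ 2 - b ^+ 2).
Proof.
move=> a0 b0 q0.
have := @conjugate_powR _ (a `^ q) (b `^ 2) ((q + 2) / q) ((q + 2) / 2)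
  (powR_ge0 _ _) (powR_ge0 _ _).
rewrite -!powRrM !divr_gt0 ?addr_gt0// => /(_ isT isT).
have -> : ((q + 2) / q)^-1 + ((q + 2) / 2)^-1 = 1.
  by field; apply/andP; split; rewrite gt_eqF//; lra.
have -> : q * ((q + 2) / q) = q + 2 by field; rewrite gt_eqF.
have -> : 2 * ((q + 2) / 2) = q + 2 by field.
move=> /(_ erefl); rewrite powR_mulrn// => h.
have q2 : 0 < (q + 2) / 2 by lra.
have := ler_wpM2l (ltW q2) h.
have -> : (q + 2) / 2 * (a `^ (q + 2) / ((q + 2) / q) + b `^ (q + 2) / ((q + 2) / 2))
  = q / 2 * a `^ (q + 2) + b `^ (q + 2).
  by field; apply/andP; split; rewrite gt_eqF//; lra.
rewrite mulrBr -[_ * _ * a ^+ 2]mulrA -powRD2//; lra.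
Qed.

(** A substitute for letting t tend to 0 in variational arguments. *)
Lemma ge0_of_small_slope A B t0 : 0 < t0 ->
  (forall t, 0 < t <= t0 -> 0 <= A + t * B) -> 0 <= A.
Proof.
move=> t00 h; rewrite leNgt; apply/negP => A0.
have B0 : 0 < `|B| + 1 by rewrite ltr_wpDl.
pose t := Num.min t0 (- A / (`|B| + 1) / 2).
have t0' : 0 < t by rewrite lt_min t00 !divr_gt0// oppr_gt0.
have := h t; rewrite t0' ge_min lexx => /(_ isT).
have tB : t * (`|B| + 1) <= - A / 2.
  by rewrite -ler_pdivlMr// [leRHS]mulrAC ge_min lexx orbT.
have : t * B <= t * (`|B| + 1).
  rewrite ler_wpM2l ?(ltW t0')//; apply: le_trans (ler_norm _) _; lra.
lra.
Qed.

(** This is Bernoulli's inequality in the two forms (1 + t)^q <= 1 + t and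
    1 - t <= (1 - t)^q, which hold for an exponent at most 1. *)
Lemma powR_perturb a b t q : 0 < a -> 0 <= b -> 0 < q <= 1 -> 0 <= t ->
  `|b - a| <= t * a -> t <= 1 -> `|b `^ q - a `^ q| <= t * a `^ q.
Proof.
move=> a0 b0 /andP[q0 q1] t0; rewrite !ler_norml => /andP[l u] t1.
have aq : 0 <= a `^ q := powR_ge0 _ _.
have hi : b `^ q <= (1 + t) * a `^ q.
  apply: (@le_trans _ _ (((1 + t) * a) `^ q)).
    apply: ge0_ler_powR; rewrite ?nnegrE; [lra|lra|nra|lra].
  rewrite powRM; [|lra|lra]; rewrite ler_wpM2r// ler1_powR//; lra.
have lo : (1 - t) * a `^ q <= b `^ q.
  move: t1; rewrite le_eqVlt => /predU1P[->|t1]; first by rewrite subrr mul0r powR_ge0.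
  apply: (@le_trans _ _ (((1 - t) * a) `^ q)).
    rewrite powRM; [|lra|lra]; rewrite ler_wpM2r// ger1_powR//; lra.
  apply: ge0_ler_powR; rewrite ?nnegrE; [lra|nra|lra|lra].
lra.
Qed.

End Powers.

(** * Functions along a line *)

Section Lines.
Context {R : realType}.

Lemma is_derive_line (V W : normedModType R) (g : V -> W) (x s : V) (t : R) :
  differentiable g (x + t *: s) ->
  is_derive t 1 (fun t : R => g (x + t *: s)) ('D_s g (x + t *: s)).
Proof.
move=> dg.
have E : (fun h : R => h^-1 *: (((fun t : R => g (x + t *: s)) \o shift t) (h *: 1)
            - g (x + t *: s))) =
         (fun h : R => h^-1 *: ((g \o shift (x + t *: s)) (h *: s) - g (x + t *: s))).
  apply/funext => h /=; congr (_ *: (g _ - _)).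
  by rewrite [h *: 1]mulr1 scalerDl addrCA.
split; first by rewrite /derivable E; exact: diff_derivable.
by rewrite /derive E.
Qed.

Lemma continuous_line (V : normedModType R) (x s : V) :
  continuous (fun t : R => x + t *: s).
Proof.
by move=> t; apply: cvgD; [exact: cvg_cst | exact: scalel_continuous].
Qed.

Lemma derive_grad m (f : 'rV[R]_m -> R) x s : differentiable f x ->
  'D_s f x = dot (grad f x) s.
Proof.
move=> df; rewrite deriveE// [X in 'd f x X]row_sum_delta linear_sum.
by apply: eq_bigr => i _; rewrite linearZ/= mxE mulrC deriveE.
Qed.

Lemma is_derive_line_fun m (f : 'rV[R]_m -> R) x s (t : R) :
  (forall y, differentiable f y) ->
  is_derive t 1 (fun t : R => f (x + t *: s)) (dot (grad f (x + t *: s)) s).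
Proof. by move=> df; rewrite -derive_grad//; exact: is_derive_line. Qed.

Lemma is_derive_line_grad m (f : 'rV[R]_m -> R) x s v (t : R) :
  (forall y, differentiable (grad f) y) ->
  is_derive t 1 (fun t : R => dot (grad f (x + t *: s)) v)
    (dot (s *m hess f (x + t *: s)) v).
Proof.
move=> df; have := is_derive_line (df (x + t *: s)).
rewrite deriveEjacobian// -/(hess f _) => -[d1 d2].
have di i : is_derive t 1 (fun t : R => grad f (x + t *: s) 0 i * v 0 i)
   ((s *m hess f (x + t *: s)) 0 i * v 0 i).
  have di : is_derive t 1 (fun t : R => grad f (x + t *: s) 0 i)
     ((s *m hess f (x + t *: s)) 0 i).
    split; first by move/derivable_mxP : d1; exact.
    by rewrite -d2 derive_mx// mxE.
  have := @is_deriveM _ _ _ (cst (v 0 i)) _ _ _ _ di (is_derive_cst _ _ _).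
  by rewrite scaler0 add0r [_ *: _]mulrC.
rewrite [X in is_derive _ _ X](_ : _ =
  \sum_(i < m) (fun t : R => grad f (x + t *: s) 0 i * v 0 i)); last first.
  by apply/funext => u; rewrite fct_sumE.
exact: is_derive_sum.
Qed.

(** The mean value theorem for phi - K / (a + 1) t^(a + 1). The power may fail to
    be continuous from the left at 0, hence the one-sided limit there. *)
Lemma le_increment_powR (phi dphi : R -> R) (K a : R) : 0 < a ->
  (forall t : R, is_derive t 1 phi (dphi t)) ->
  (forall t, 0 < t < 1 -> dphi t <= K * t `^ a) ->
  phi 1 - phi 0 <= K / (a + 1).
Proof.
move=> a0 dp le; have a1 : a + 1 != 0 by rewrite gt_eqF// addr_gt0.
pose psi t := phi t - (K / (a + 1)) *: (t `^ (a + 1)).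
have dpsi (t : R) : 0 < t ->
    is_derive t 1 psi (dphi t - (K / (a + 1)) *: ((a + 1) * t `^ a)).
  move=> t0; have := is_derive1_powR (a + 1) t0; rewrite addrK => h.
  exact: is_deriveB.
have phic : continuous phi.
  by move=> t; apply/differentiable_continuous/derivable1_diffP;
    exact: (@ex_derive _ _ _ _ _ _ _ (dp t)).
have psic t : 0 < t -> {for t, continuous psi}.
  by move=> t0; apply/differentiable_continuous/derivable1_diffP;
    exact: (@ex_derive _ _ _ _ _ _ _ (dpsi t t0)).
have [|||c] := @MVT R psi (fun t => dphi t - (K / (a + 1)) *: ((a + 1) * t `^ a)) 0 1.
- exact: ltr01.
- by move=> t; rewrite in_itv/= => /andP[t0 _]; exact: dpsi.
- apply/(continuous_within_itvP _ ltr01); split.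
  + by move=> t; rewrite in_itv/= => /andP[t0 _]; exact: psic.
  + apply: cvgB; first by apply: cvg_at_right_filter; exact: phic.
    apply: cvgZr; rewrite powR0//; apply: powR_cvg0; lra.
  + by apply: cvg_at_left_filter; apply: psic.
rewrite in_itv/= => /le h; rewrite /psi powR1 powR0// scaler0 !subr0 mulr1.
rewrite [_ *: 1]mulr1 [_ *: _]mulrA divfK//; lra.
Qed.

End Lines.

(** * Symmetry of the Hessian *)

Section Schwarz.
Context {R : realType} {m : nat}.
Implicit Types (f : 'rV[R]_m -> R) (x u v a b : 'rV[R]_m).

Lemma grad_linearization f x (eps : R) : 0 < eps -> differentiable (grad f) x ->
  exists2 d : R, 0 < d & forall h, enorm h < d ->
    enorm (grad f (x + h) - grad f x - h *m hess f x) <= eps * enorm h.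
Proof.
move=> e0 df; have m0 : 0 < (m.+1%:R : R) by rewrite ltr0n.
have [_ /eqaddoP hlin] := (diff_locallyP _ _).1 df.
have /nbhs_norm0P[d /= d0 hd] := hlin _ (divr_gt0 e0 m0).
exists d => // h hh; have {hd} := hd h (le_lt_trans (norm_le_enorm h) hh).
rewrite -[(_ - _) h]/(grad f (h + x) - (grad f x + 'd (grad f) x h)).
rewrite -(mul_rV_lin1 ('d (grad f) x)) -/(hess f x) [h + x]addrC opprD addrA => le.
apply: le_trans (enorm_le_norm _) _.
apply: (@le_trans _ _ (m.+1%:R * (eps / m.+1%:R * `|h|))).
  by apply: ler_pM => //; rewrite ler_nat.
rewrite [leLHS](_ : _ = eps * `|h|); last by field; rewrite gt_eqF.
by rewrite ler_wpM2l ?norm_le_enorm// ltW.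
Qed.

(** By the mean value theorem in the direction a, the second difference is a
    difference of gradients tested against a, and the linearization of the
    gradient at x evaluates it. *)
Lemma second_difference f x a b (eps d : R) : 0 < eps ->
  (forall y, differentiable f y) ->
  (forall h, enorm h < d ->
    enorm (grad f (x + h) - grad f x - h *m hess f x) <= eps * enorm h) ->
  enorm a + enorm b < d ->
  `|f (x + a + b) - f (x + a) - f (x + b) + f x - dot (b *m hess f x) a|
    <= 2 * eps * (enorm a + enorm b) ^+ 2.
Proof.
move=> e0 df lin abd.
have Dphi (t : R) : is_derive t 1 (fun t : R => f ((x + b) + t *: a) - f (x + t *: a))
    (dot (grad f ((x + b) + t *: a)) a - dot (grad f (x + t *: a)) a).
  by apply: is_deriveB; exact: is_derive_line_fun.
have phic : {within `[0, 1], continuous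
    fun t : R => f ((x + b) + t *: a) - f (x + t *: a)}.
  apply: continuous_subspaceT => t.
  apply/differentiable_continuous/derivable1_diffP.
  exact: (@ex_derive _ _ _ _ _ _ _ (Dphi t)).
have [t] := MVT ltr01 (fun t _ => Dphi t) phic.
rewrite in_itv/= => /andP[t0 t1]; rewrite !scale0r !addr0 !scale1r subr0 mulr1.
rewrite -dotBl -!addrA (addrC b (_ *: _)) (addrC b a) => E.
have na := enorm_ge0 a; have nb := enorm_ge0 b.
have nta : enorm (t *: a) <= enorm a.
  by rewrite enormZ (gtr0_norm t0) ler_piMl// ltW.
have ntab : enorm (t *: a + b) <= enorm a + enorm b.
  by apply: le_trans (enormD _ _) _; rewrite lerD2r.
set e1 := grad f (x + (t *: a + b)) - grad f x - (t *: a + b) *m hess f x.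
set e2 := grad f (x + t *: a) - grad f x - (t *: a) *m hess f x.
have le1 : enorm e1 <= eps * (enorm a + enorm b).
  apply: le_trans (lin _ (le_lt_trans ntab abd)) _.
  by rewrite ler_wpM2l// ltW.
have le2 : enorm e2 <= eps * (enorm a + enorm b).
  have tab : enorm (t *: a) <= enorm a + enorm b by rewrite ler_wpDr.
  apply: le_trans (lin _ (le_lt_trans tab abd)) _.
  by rewrite ler_wpM2l// ltW.
rewrite [X in `|X|](_ : _ = dot (e1 - e2) a); last first.
  have -> : e1 - e2 = grad f (x + (t *: a + b)) - grad f (x + t *: a) - b *m hess f x.
    by rewrite /e1 /e2 mulmxDl; apply/rowP => i; rewrite !mxE; lra.
  by rewrite dotBl -E; lra.
have ne : enorm (e1 - e2) <= 2 * eps * (enorm a + enorm b).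
  by apply: le_trans (enormD _ _) _; rewrite enormN; lra.
have := cauchy_schwarz (e1 - e2) a; have := cauchy_schwarzN (e1 - e2) a.
have : enorm (e1 - e2) * enorm a <= 2 * eps * (enorm a + enorm b) ^+ 2.
  rewrite expr2 mulrA ler_pM ?enorm_ge0//; lra.
rewrite ler_norml; lra.
Qed.

(** The second difference is symmetric in its two increments. Symmetry matters
    because minimizing the model only sees the symmetric part of the Hessian,
    while the expansion of the gradient involves the Hessian itself. *)
Lemma hess_sym f x u v : (forall y, differentiable f y) ->
  differentiable (grad f) x -> dot (u *m hess f x) v = dot (v *m hess f x) u.
Proof.
move=> df dg; apply/eqP; rewrite -subr_eq0 -normr_le0; apply/ler_addgt0Pr => e e0.
rewrite add0r; have [n En] : {n | enorm u + enorm v = n} by eexists.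
have n0 : 0 <= n by rewrite -En addr_ge0 ?enorm_ge0.
pose eps := e / (4 * (n ^+ 2 + 1)).
have n1 : 0 < n ^+ 2 + 1 by rewrite ltr_wpDl ?sqr_ge0.
have eps0 : 0 < eps by rewrite divr_gt0// mulr_gt0.
have [d d0 lin] := grad_linearization eps0 dg.
have [t t0 tn] : exists2 t : R, 0 < t & t * n < d.
  exists (d / (n + 1)); first by rewrite divr_gt0// ltr_wpDl.
  by rewrite mulrAC ltr_pdivrMr ?ltr_wpDl// mulrDr mulr1 ltrDl.
have nE w : enorm (t *: w) = t * enorm w by rewrite enormZ gtr0_norm.
have sd : enorm (t *: u) + enorm (t *: v) < d by rewrite !nE -mulrDr En.
have h1 := second_difference eps0 df lin sd.
have := sd; rewrite addrC => /(second_difference eps0 df lin).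
move: h1; rewrite !nE -!mulrDr [enorm v + _]addrC En (addrAC _ (t *: v)).
rewrite -!scalemxAl !dotZl !dotZr => h1 h2.
have : `|t * (t * (dot (u *m hess f x) v - dot (v *m hess f x) u))| <=
   t * (t * (4 * eps * n ^+ 2)).
  by move: h1 h2; rewrite !ler_norml; nra.
rewrite !normrM (gtr0_norm t0) !ler_pM2l// => /le_trans; apply.
have E : eps * (4 * (n ^+ 2 + 1)) = e by rewrite divfK// gt_eqF// mulr_gt0.
by rewrite -[leRHS]E; lra.
Qed.

End Schwarz.

(** * Taylor bounds under a Hoelder condition *)

Section Taylor.
Context {R : realType} {m : nat}.
Implicit Types (f : 'rV[R]_m -> R) (x s v : 'rV[R]_m).

(** Only the segment matters for the Taylor bounds; this lets them be applied
    before the endpoint of a whole step is known to lie in the domain of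
    smoothness. *)
Definition holder_segment f x s (L q : R) := forall t : R, 0 <= t <= 1 ->
  opnorm (hess f (x + t *: s) - hess f x) <= L * enorm (t *: s) `^ q.

Lemma holder_segmentZ f x s L q (t : R) : 0 <= t <= 1 ->
  holder_segment f x s L q -> holder_segment f x (t *: s) L q.
Proof.
move=> /andP[t0 t1] h u /andP[u0 u1]; rewrite scalerA; apply: h.
by rewrite mulr_ge0//= mulr_ile1.
Qed.

(** The Hoelder bound is integrated along the segment, for the component of the
    gradient in the direction of the remainder itself. *)
Lemma grad_taylor f x s L q : C2 f -> 0 < q -> 0 <= L ->
  holder_segment f x s L q ->
  enorm (grad f (x + s) - grad f x - s *m hess f x)
    <= L / (q + 1) * enorm s `^ (q + 1).
Proof.
move=> [_ dg _] q0 L0 hH; have q1 : 0 < q + 1 by lra.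
apply: enorm_le_dot; first by rewrite mulr_ge0 ?powR_ge0 ?divr_ge0// ltW.
set v := _ - s *m _.
pose phi (t : R) := dot (grad f (x + t *: s)) v - t * dot (s *m hess f x) v.
have Dphi (t : R) : is_derive t 1 phi
    (dot (s *m hess f (x + t *: s)) v - dot (s *m hess f x) v).
  apply: is_deriveB; first exact: is_derive_line_grad.
  have := @is_deriveM _ _ id (cst (dot (s *m hess f x) v)) t 1 _ _
    (is_derive_id _ _) (is_derive_cst _ _ _).
  by rewrite scaler0 add0r [_ *: 1]mulr1.
have := @le_increment_powR R phi _ (L * enorm s `^ (q + 1) * enorm v) q q0 Dphi.
have vE : phi 1 - phi 0 = dot v v.
  by rewrite /phi scale1r scale0r addr0 mul1r mul0r subr0 /v !dotBl; lra.
rewrite vE; move=> h.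
rewrite [leRHS](_ : _ = L * enorm s `^ (q + 1) * enorm v / (q + 1)); last by ring.
apply: h => t /andP[t0 t1].
rewrite -dotBl -mulmxBr; apply: le_trans (dot_mulmx_le _ _ _) _.
rewrite [leRHS]mulrAC ler_wpM2r ?enorm_ge0//.
have := hH t; rewrite (ltW t0) (ltW t1) => /(_ isT).
rewrite enormZ (gtr0_norm t0) powRM ?enorm_ge0// ?(ltW t0)// powRS ?enorm_ge0// => h'.
rewrite [leRHS](_ : _ = L * (t `^ q * enorm s `^ q) * enorm s); last by ring.
by rewrite ler_wpM2r ?enorm_ge0.
Qed.

(** The bound of grad_taylor at the intermediate points is integrated once
    more. *)
Lemma fun_taylor f x s L q : C2 f -> 0 < q -> 0 <= L ->
  holder_segment f x s L q ->
  f (x + s) - f x - dot (grad f x) s - 2^-1 * dot (s *m hess f x) s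
    <= L / ((q + 1) * (q + 2)) * enorm s `^ (q + 2).
Proof.
move=> C2f q0 L0 hH; have [df _ _] := C2f; have q1 : 0 < q + 1 by lra.
pose g := dot (grad f x) s; pose h := dot (s *m hess f x) s.
pose phi (t : R) := f (x + t *: s) - (t * g + 2^-1 * h * (t * t)).
have Dphi (t : R) : is_derive t 1 phi (dot (grad f (x + t *: s)) s - (g + t * h)).
  apply: is_deriveB; first exact: is_derive_line_fun.
  have d1 : is_derive t 1 (fun t : R => t * g) g.
    have := @is_deriveM _ _ id (cst g) t 1 _ _
      (is_derive_id _ _) (is_derive_cst _ _ _).
    by rewrite scaler0 add0r [_ *: 1]mulr1.
  have d2 : is_derive t 1 (fun t : R => 2^-1 * h * (t * t)) (t * h).
    have dtt := @is_deriveM _ _ id id t 1 _ _ (is_derive_id t 1) (is_derive_id t 1).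
    have := @is_deriveZ _ _ _ _ (2^-1 * h) t 1 _ dtt.
    by congr is_derive; rewrite -[LHS]/(_ * (_ * 1 + _ * 1)); field.
  exact: is_deriveD.
have := @le_increment_powR R phi _ (L / (q + 1) * enorm s `^ (q + 2)) (q + 1) q1 Dphi.
have vE : phi 1 - phi 0 = f (x + s) - f x - g - 2^-1 * h.
  by rewrite /phi scale1r scale0r addr0; lra.
rewrite vE -/g -/h => H.
rewrite [leRHS](_ : _ = L / (q + 1) * enorm s `^ (q + 2) / (q + 1 + 1)); last first.
  by field; apply/andP; split; rewrite gt_eqF//; lra.
apply: H => t /andP[t0 t1].
have t01 : 0 <= t <= 1 by rewrite !ltW.
have := grad_taylor C2f q0 L0 (holder_segmentZ t01 hH).
have -> : dot (grad f (x + t *: s)) s - (g + t * h) =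
    dot (grad f (x + t *: s) - grad f x - (t *: s) *m hess f x) s.
  by rewrite !dotBl -scalemxAl dotZl /g /h; lra.
move=> le; apply: le_trans (cauchy_schwarz _ _) _.
rewrite [q + 2](_ : _ = q + 1 + 1); last by lra.
rewrite powRS ?enorm_ge0//.
have -> : L / (q + 1) * (enorm s `^ (q + 1) * enorm s) * t `^ (q + 1) =
   L / (q + 1) * enorm (t *: s) `^ (q + 1) * enorm s.
  rewrite enormZ (gtr0_norm t0) powRM ?enorm_ge0// ?(ltW t0)//; ring.
by rewrite ler_wpM2r ?enorm_ge0.
Qed.

End Taylor.

(** * Minimizers of the regularized model *)

Section ModelMinimizer.
Context {R : realType} {m : nat}.
Variables (g : 'rV[R]_m) (H : 'M[R]_m) (q sigma : R) (s : 'rV[R]_m).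
Hypothesis Hsym : forall u v, dot (u *m H) v = dot (v *m H) u.
Hypothesis q01 : 0 < q <= 1.
Hypothesis sigma0 : 0 < sigma.
Let M d := dot g d + 2^-1 * dot (d *m H) d
  + sigma / ((q + 1) * (q + 2)) * enorm d `^ (q + 2).
Hypothesis smin : forall d, M s <= M d.

Let q0 : 0 < q. Proof. by case/andP: q01. Qed.
Let q1 : 0 < q + 1. Proof. by rewrite addr_gt0. Qed.
Let q2 : 0 < q + 2. Proof. by rewrite addr_gt0. Qed.

Let lam := sigma / (q + 1) * enorm s `^ q.

Let lam0 : 0 <= lam.
Proof. by rewrite mulr_ge0 ?powR_ge0 ?divr_ge0// ltW. Qed.

Let model_diff u t : M (s + t *: u) - M s =
  t * (dot g u + dot (s *m H) u) + t ^+ 2 / 2 * dot (u *m H) u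
  + sigma / ((q + 1) * (q + 2)) * (enorm (s + t *: u) `^ (q + 2) - enorm s `^ (q + 2)).
Proof.
rewrite /M mulmxDl -scalemxAl !dotDr !dotDl !dotZr !dotZl (Hsym u s); lra.
Qed.

Lemma sqr_enormD u (t : R) :
  enorm (s + t *: u) ^+ 2 - enorm s ^+ 2 = t * (2 * dot s u + t * enorm u ^+ 2).
Proof. rewrite !enorm_sqr !dotDl !dotDr !dotZr !dotZl (dotC u s); lra. Qed.

(** Comparing s with s + t u for small t > 0, the tangent inequality turns the
    variation of the power of the norm into that of the squared norm, and the
    first-order part in t must be nonnegative for every u. *)
Lemma model_first_order : g + s *m H + lam *: s = 0.
Proof.
have key u : 0 <= dot (g + s *m H + lam *: s) u.
  (* For s <> 0 the bound on t makes t |u| <= |s|, as powR_perturb requires. *)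
  pose t0 := if s == 0 then 1 else Num.min 1 (enorm s / (enorm u + 1)).
  have u1 : 0 < enorm u + 1 by rewrite ltr_wpDl ?enorm_ge0.
  have t00 : 0 < t0.
    rewrite /t0; case: eqVneq => [//|/enorm_gt0 s0].
    by rewrite lt_min ltr01 divr_gt0.
  have t01 : t0 <= 1 by rewrite /t0; case: ifP => // _; rewrite ge_min lexx.
  have pert t : 0 < t <= t0 ->
      dot s u * enorm (s + t *: u) `^ q <=
      dot s u * enorm s `^ q + t * (enorm u ^+ 2 * enorm s `^ q).
    move=> /andP[tp tt0]; have [->|sn0] := eqVneq s 0.
      rewrite dot0l !mul0r add0r; apply: mulr_ge0 (ltW tp) _.
      by apply: mulr_ge0; [exact: sqr_ge0|exact: powR_ge0].
    have s0 := enorm_gt0 sn0.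
    have ts : t * enorm u <= enorm s.
      have : t <= enorm s / (enorm u + 1).
        by apply: le_trans tt0 _; rewrite /t0 (negbTE sn0) ge_min lexx orbT.
      by rewrite ler_pdivlMr//; nra.
    have := @powR_perturb _ (enorm s) (enorm (s + t *: u)) (t * enorm u / enorm s) q
      s0 (enorm_ge0 _) q01.
    rewrite divr_ge0 ?mulr_ge0 ?enorm_ge0 ?(ltW tp)// divfK ?gt_eqF// => /(_ isT).
    have -> : `|enorm (s + t *: u) - enorm s| <= t * enorm u.
      have E1 := enormD s (t *: u).
      have E2 := enormD (s + t *: u) (- (t *: u)).
      move: E1 E2; rewrite addrK enormN enormZ gtr0_norm// ler_norml; lra.
    rewrite ler_pdivrMr// mul1r => /(_ isT ts) le.
    rewrite -lerBlDl -mulrBr; apply: le_trans (ler_norm _) _; rewrite normrM.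
    have ds : `|dot s u| <= enorm s * enorm u.
      by rewrite ler_norml cauchy_schwarz cauchy_schwarzN.
    apply: le_trans (ler_pM _ _ ds le) _ => //.
    rewrite le_eqVlt; apply/orP; left; apply/eqP; field; by rewrite gt_eqF.
  pose B := 2^-1 * dot (u *m H) u + sigma / (q + 1) * (enorm u ^+ 2 * enorm s `^ q)
     + sigma / (q + 1) / 2 * ((enorm s + enorm u) `^ q * enorm u ^+ 2).
  apply: (@ge0_of_small_slope _ _ B t0) => // t /[dup] tt0 /andP[tp tle].
  have := smin (s + t *: u); rewrite -subr_ge0 model_diff.
  set N := enorm (s + t *: u); rewrite /= => h.
  have N0 : 0 <= N := enorm_ge0 _.
  have Nle : N `^ q <= (enorm s + enorm u) `^ q.
    apply: ge0_ler_powR; rewrite ?nnegrE ?addr_ge0 ?enorm_ge0 ?(ltW q0)//.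
    apply: le_trans (enormD _ _) _; rewrite lerD2l enormZ gtr0_norm//.
    by rewrite ler_piMl ?enorm_ge0// (le_trans tle).
  have c0 : 0 < sigma / ((q + 1) * (q + 2)) by rewrite divr_gt0// mulr_gt0.
  have := ler_wpM2l (ltW c0) (@powRD2_tangent _ N (enorm s) q N0 (enorm_ge0 _) q0).
  rewrite sqr_enormD => h2.
  have {h h2} : 0 <= t * (dot g u + dot (s *m H) u + t / 2 * dot (u *m H) u
     + sigma / (q + 1) * (dot s u * N `^ q) + sigma / (q + 1) / 2 * t * (N `^ q * enorm u ^+ 2)).
    apply: le_trans h _.
    apply: (le_trans (lerD (lexx _) h2)).
    rewrite le_eqVlt; apply/orP; left; apply/eqP; field.
    by apply/andP; split; rewrite gt_eqF.
  rewrite pmulr_rge0// => h; apply: le_trans h _.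
  rewrite !dotDl dotZl /B /lam.
  have c1 : 0 < sigma / (q + 1) by rewrite divr_gt0.
  have e1 := ler_wpM2l (ltW c1) (pert t tt0).
  have e2 : sigma / (q + 1) / 2 * t * (N `^ q * enorm u ^+ 2) <=
     sigma / (q + 1) / 2 * t * ((enorm s + enorm u) `^ q * enorm u ^+ 2).
    rewrite ler_wpM2l//; first by rewrite mulr_ge0 ?(ltW tp)// divr_ge0 ?(ltW c1).
    by rewrite ler_wpM2r ?sqr_ge0.
  rewrite -/N in e1; lra.
apply: enorm_eq0; apply/eqP; rewrite eq_le enorm_ge0 andbT.
have := key (- (g + s *m H + lam *: s)); rewrite dotNr oppr_ge0 -enorm_sqr.
by move=> h; rewrite -(@ler_pXn2r _ 2) ?nnegrE ?enorm_ge0// expr0n.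
Qed.

(** If s and u are not orthogonal, s has a mirror image s + t u with t != 0 of
    the same norm. The power terms of the model then cancel and only the
    quadratic part remains, which gives a bound that is global, not merely
    local. Directions orthogonal to s are limits of such u; if s = 0, the power
    has higher order than 2 and scaling suffices. *)
Lemma model_second_order u : - (lam * enorm u ^+ 2) <= dot (u *m H) u.
Proof.
rewrite -subr_ge0 opprK addrC.
have fo v : dot g v + dot (s *m H) v = - lam * dot s v.
  have : dot (g + s *m H + lam *: s) v = 0 by rewrite model_first_order dot0l.
  rewrite !dotDl dotZl; lra.
have [s0|sn0] := eqVneq s 0.
  rewrite /lam s0 enorm0 powR0 ?gt_eqF// mulr0 mul0r add0r.
  pose B := 2 * (sigma / ((q + 1) * (q + 2))) * enorm u `^ (q + 2).
  apply: (@ge0_of_small_slope _ _ B 1) => // e /andP[e0 _].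
  (* Scaled so that t^q = e, the power term being t^q times the quadratic. *)
  pose t := e `^ (q^-1).
  have t0 : 0 < t by rewrite powR_gt0.
  have tq : t `^ q = e by rewrite /t -powRrM mulVf ?gt_eqF// powRr1// ltW.
  have := smin (s + t *: u); rewrite -subr_ge0 model_diff fo s0 dot0l mulr0 mulr0 !add0r.
  rewrite enorm0 powR0 ?gt_eqF// subr0 enormZ gtr0_norm// powRM ?enorm_ge0 ?(ltW t0)//.
  rewrite (powRD2 (ltW t0) q0) tq => h.
  have : 0 <= t ^+ 2 / 2 * (dot (u *m H) u + e * B).
    apply: le_trans h _; rewrite /B le_eqVlt; apply/orP; left; apply/eqP; field.
    by apply/andP; split; rewrite gt_eqF.
  by rewrite pmulr_rge0// divr_gt0// exprn_gt0.
have reflect v : dot s v != 0 -> 0 <= lam * enorm v ^+ 2 + dot (v *m H) v.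
  move=> sv; have vn0 : v != 0 by apply: contra_neq sv => ->; rewrite dot0r.
  have v0 : 0 < enorm v ^+ 2 by rewrite exprn_gt0// enorm_gt0.
  (* The nonzero solution t of |s + t v| = |s|. *)
  pose t := - (2 * dot s v / enorm v ^+ 2).
  have tE : dot s v = - (t * enorm v ^+ 2 / 2)
    by rewrite /t; field; rewrite gt_eqF // enorm_gt0.
  have Ns : enorm (s + t *: v) = enorm s.
    apply/eqP; rewrite -(@eqrXn2 _ 2) ?enorm_ge0// -subr_eq0 sqr_enormD.
    by apply/eqP; rewrite tE; lra.
  have := smin (s + t *: v); rewrite -subr_ge0 model_diff Ns subrr mulr0 addr0 fo tE => h.
  have : 0 <= t ^+ 2 / 2 * (lam * enorm v ^+ 2 + dot (v *m H) v).
    by apply: le_trans h _; lra.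
  rewrite pmulr_rge0// divr_gt0// exprn_even_gt0//= /t oppr_eq0.
  by rewrite mulf_eq0 invr_eq0 (gt_eqF v0) orbF mulf_eq0 pnatr_eq0.
have [su|] := eqVneq (dot s u) 0; last exact: reflect.
have ss : 0 < dot s s by rewrite -enorm_sqr exprn_gt0// enorm_gt0.
have hs := reflect s; rewrite gt_eqF// in hs; have {}hs := hs isT.
apply: (@ge0_of_small_slope _ _ (2 * dot (u *m H) s +
  (lam * enorm s ^+ 2 + dot (s *m H) s)) 1) => //.
move=> e /andP[e0 e1].
have := reflect (u + e *: s).
rewrite dotDr su add0r dotZr mulf_neq0 ?gt_eqF// => /(_ isT).
rewrite !enorm_sqr mulmxDl -scalemxAl !dotDl !dotDr !dotZl !dotZr (dotC u s) su.
rewrite (Hsym s u) -!enorm_sqr => h; apply: le_trans h _.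
have e1' : 0 <= 1 - e by rewrite subr_ge0.
have := mulr_ge0 (mulr_ge0 (ltW e0) e1') hs; lra.
Qed.

End ModelMinimizer.

(** * One step of the algorithm *)

Lemma addr_regroup (V : zmodType) (g A B C l : V) :
  (g - C) + (C + B) + (A - B) + l = g + A + l.
Proof. by rewrite !addrA subrK [g + B + A]addrAC addrK. Qed.

(** The arithmetic core of step_le_dist. There r is the length of the step, D the
    distance to a stationary point, Dq and rq their powers of exponent q, lam
    the regularization coefficient and w the distance from the new point to
    the stationary one; a, b, c and lam sw are the inner products that sum up
    to 0 by the first-order condition. For 2 D <= r they force rq <= (27 / 2) Dq,
    which is where the constant 14 comes from. *)
Lemma long_step_absurd (R : realFieldType) (L lam Dq rq D r w e h a b c sw : R) :
  0 < L -> 0 <= Dq -> 14 * Dq < rq -> 0 <= D -> 0 < r -> 2 * D <= r ->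
  L / 3 * rq <= lam -> 0 <= w -> w <= r + D ->
  e <= L * Dq * D -> h <= L * Dq * r ->
  - (e * w) <= a -> 0 <= b -> - (h * w) <= c -> r ^+ 2 - r * D <= sw ->
  a + b + c + lam * sw = 0 -> False.
Proof.
move=> L0 Dq0 rqD D0 r0 r2D lamr w0 wle eD hD ae b0 ch swr eq0.
have LD : 0 <= L * Dq by rewrite mulr_ge0// ltW.
have lam0 : 0 <= lam.
  by apply: le_trans lamr; rewrite mulr_ge0 ?divr_ge0// ?ltW//; lra.
have c1 : lam * (r ^+ 2 / 2) <= lam * sw.
  by rewrite ler_wpM2l//; apply: le_trans swr; nra.
have c2 : e * w <= L * Dq * D * w by rewrite ler_wpM2r.
have c3 : h * w <= L * Dq * r * w by rewrite ler_wpM2r.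
have c4 : L * Dq * ((D + r) * w) <= L * Dq * (9 / 4 * r ^+ 2).
  rewrite ler_wpM2l//; apply: (@le_trans _ _ ((D + r) * (r + D))); last nra.
  by rewrite ler_wpM2l//; lra.
have r20 : 0 < r ^+ 2 by rewrite exprn_gt0.
have c5 : lam <= L * (9 / 2 * Dq) by rewrite -(ler_pM2r r20); lra.
have c6 : L * (rq / 3) <= L * (9 / 2 * Dq) by apply: le_trans c5; lra.
move: c6; rewrite ler_pM2l//; lra.
Qed.

Section Step.
Context {R : realType} {m : nat}.
Variables (f : 'rV[R]_m -> R) (F : set 'rV[R]_m) (a L2 q sigmabar : R).
Hypothesis C2f : C2 f.
Hypothesis q01 : 0 < q <= 1.
Hypothesis L20 : 0 < L2.
Hypothesis Fcl : closed F.
Hypothesis Fcvx : convex_set (F : set (convex_lmodType 'rV[R]_m)).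
Hypothesis subF : sublevel f a `<=` F°.
Hypothesis Fholder : forall x y, F x -> F y ->
  opnorm (hess f x - hess f y) <= L2 * enorm (x - y) `^ q.
Hypothesis sbar : 2 * L2 / (q + 2) < sigmabar <= L2.

Let q0 : 0 < q. Proof. by case/andP: q01. Qed.
Let q1 : 0 < q + 1. Proof. by rewrite addr_gt0. Qed.
Let q2 : 0 < q + 2. Proof. by rewrite addr_gt0. Qed.

Let sbar0 : 0 < sigmabar.
Proof.
case/andP: sbar => h _; apply: le_lt_trans h.
by rewrite divr_ge0 ?mulr_ge0 ?ltW.
Qed.

Let sbar_third : L2 / 3 * (q + 1) <= sigmabar.
Proof.
case/andP: sbar => h _; apply: le_trans (ltW h).
rewrite ler_pdivlMr// -mulrA.
have : (q + 1) * (q + 2) <= 2 * 3 by case/andP: q01 => *; nra.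
by move=> /(ler_wpM2l (divr_ge0 (ltW L20) (ler0n R 3))); lra.
Qed.

Lemma sublevelF y : f y <= a -> F y.
Proof. by move=> ya; apply: interior_subset; exact: subF. Qed.

Lemma segmentF x s : F x -> F (x + s) -> forall t, 0 <= t <= 1 -> F (x + t *: s).
Proof.
move=> Fx Fxs t /andP[t0 t1].
have := @Fcvx (x + s) x (Itv01 t0 t1) (mem_set Fxs) (mem_set Fx).
move=> /set_mem; rewrite /conv/=.
rewrite scalerDr scalerBl scale1r [X in F X](_ : _ = x + t *: s)//.
by apply/rowP => i; rewrite !mxE; lra.
Qed.

Lemma segment_holder x s : F x -> F (x + s) -> holder_segment f x s L2 q.
Proof.
move=> Fx Fxs t t01; have := Fholder (segmentF Fx Fxs t01) Fx.
by rewrite [x + _ - x]addrC addKr.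
Qed.

(** The gap between the lower bound on the regularization parameter and the
    Taylor remainder; this is where the threshold 2 L2 / (q + 2) comes from. *)
Definition decrease_rate : R := (sigmabar / 2 - L2 / (q + 2)) / (q + 1).

Lemma decrease_rate_gt0 : 0 < decrease_rate.
Proof.
case/andP: sbar => h _; rewrite divr_gt0// subr_gt0; lra.
Qed.

Section OneStep.
Variables (x xh : 'rV[R]_m) (sigma : R).
Hypothesis xa : f x <= a.
Hypothesis sigmaP : sigmabar <= sigma <= 2 * L2.
Hypothesis xhmin : argmin (model f q sigma x) setT xh.

Let s := xh - x.
Let lam := sigma / (q + 1) * enorm s `^ q.

Let sigma0 : 0 < sigma.
Proof. by case/andP: sigmaP => h _; exact: lt_le_trans h. Qed.

Let Hsym u v : dot (u *m hess f x) v = dot (v *m hess f x) u.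
Proof. by case: C2f => df dg _; exact: hess_sym. Qed.

Let smin d : dot (grad f x) s + 2^-1 * dot (s *m hess f x) s
    + sigma / ((q + 1) * (q + 2)) * enorm s `^ (q + 2) <=
  dot (grad f x) d + 2^-1 * dot (d *m hess f x) d
    + sigma / ((q + 1) * (q + 2)) * enorm d `^ (q + 2).
Proof.
have [_ /(_ (x + d) I)] := xhmin; rewrite /model -/s [x + d - x]addrC addKr; lra.
Qed.

Lemma step_first_order : grad f x + s *m hess f x + lam *: s = 0.
Proof. exact: model_first_order. Qed.

Lemma step_second_order u : - (lam * enorm u ^+ 2) <= dot (u *m hess f x) u.
Proof. exact: model_second_order. Qed.

Let xhE : x + s = xh. Proof. by rewrite addrC subrK. Qed.
Let Fx : F x. Proof. exact: sublevelF. Qed.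
Let ns0 : 0 <= enorm s. Proof. exact: enorm_ge0. Qed.

(** By the first- and second-order conditions, the quadratic Taylor polynomial
    at t s is at most f(x) - (t^2 / 2) lam |s|^2, and the Taylor remainder is
    smaller than this decrease because sigma > 2 L2 / (q + 2). *)
Lemma decrease_along_step t : 0 <= t <= 1 -> F (x + t *: s) ->
  f (x + t *: s) <= f x - t ^+ 2 * (decrease_rate * enorm s `^ (q + 2)).
Proof.
move=> /andP[t0 t1] Ft.
have := fun_taylor C2f q0 (ltW L20) (segment_holder Fx Ft).
rewrite -scalemxAl dotZl !dotZr enormZ (ger0_norm t0) powRM//.
have fo : dot (grad f x) s = - dot (s *m hess f x) s - lam * enorm s ^+ 2.
  have : dot (grad f x + s *m hess f x + lam *: s) s = 0.
    by rewrite step_first_order dot0l.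
  rewrite !dotDl dotZl enorm_sqr; lra.
have so := step_second_order s.
set P := enorm s `^ (q + 2) in fo so *.
have P0 : 0 <= P by exact: powR_ge0.
have lamE : lam * enorm s ^+ 2 = sigma / (q + 1) * P.
  by rewrite /P /lam powRD2// mulrA.
rewrite fo lamE; rewrite lamE in so; clearbody P.
set h := dot (s *m hess f x) s in so *.
have tq : t `^ (q + 2) <= t ^+ 2.
  rewrite powRD2// ler_piMl ?sqr_ge0//.
  have E1 : (1 : R) `^ q = 1 by rewrite powR1.
  rewrite -[leRHS]E1; apply: ge0_ler_powR; rewrite ?nnegrE ?(ltW q0)//.
have e1 : L2 / ((q + 1) * (q + 2)) * (t `^ (q + 2) * P) <=
  L2 / ((q + 1) * (q + 2)) * (t ^+ 2 * P).
  by rewrite ler_wpM2l ?ler_wpM2r// divr_ge0 ?mulr_ge0 ?ltW.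
have e2 : 0 <= (t - t ^+ 2 / 2) * (h + sigma / (q + 1) * P).
  rewrite mulr_ge0//; [nra|lra].
have [e3 _] := andP sigmaP.
have e4 : sigmabar / (q + 1) * (t ^+ 2 * P) <= sigma / (q + 1) * (t ^+ 2 * P).
  rewrite ler_wpM2r ?mulr_ge0 ?sqr_ge0// ler_wpM2r ?invr_ge0// ltW//.
have -> : t ^+ 2 * (decrease_rate * P) =
  (sigmabar / (q + 1) * (t ^+ 2 * P)) / 2 - L2 / ((q + 1) * (q + 2)) * (t ^+ 2 * P).
  by rewrite /decrease_rate; field; apply/andP; split; rewrite gt_eqF.
nra.
Qed.

(** The part of the segment lying in F is closed because F is, and open because
    f does not increase along it, so that it stays in a sublevel set interior to
    F; hence it is the whole segment. *)
Lemma step_inF : F xh.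
Proof.
rewrite -xhE -[s]scale1r.
pose B : set R := `[0, 1]%classic `&` [set t : R | F (x + t *: s)].
suff : B = `[0, 1]%classic.
  by move=> /seteqP[_ /(_ 1)]; rewrite /B/= in_itv/= ler01 lexx => /(_ isT)[].
have cl := @continuous_line R _ x s.
apply: (@segment_connected R 0 1).
- by exists 0; rewrite /B/= in_itv/= lexx ler01 scale0r addr0.
- exists ((fun t : R => x + t *: s) @^-1` F°).
    by apply: open_comp; [move=> t _; exact: cl | exact: open_interior].
  apply/seteqP; split => t /= [t01 Ft]; last by split => //; exact: interior_subset Ft.
  split => //.
  apply: subF; rewrite /sublevel/=; apply: le_trans xa.
  move: t01; rewrite /= in_itv/= => t01.
  apply: le_trans (decrease_along_step t01 Ft) _; rewrite gerBl.
  by rewrite mulr_ge0 ?sqr_ge0// mulr_ge0 ?powR_ge0// ltW// decrease_rate_gt0.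
- exists ((fun t : R => x + t *: s) @^-1` F) => //.
  by apply: preimage_closed => // t _; exact: cl.
Qed.

Lemma step_decrease : f xh <= f x - decrease_rate * enorm s `^ (q + 2).
Proof.
have := @decrease_along_step 1; rewrite ler01 lexx scale1r xhE => /(_ isT step_inF).
by rewrite expr1n mul1r.
Qed.

Lemma step_grad : enorm (grad f xh) <= 3 * L2 / (q + 1) * enorm s `^ (q + 1).
Proof.
have Fxs : F (x + s) by rewrite xhE; exact: step_inF.
have := grad_taylor C2f q0 (ltW L20) (segment_holder Fx Fxs); rewrite xhE.
set e := _ - s *m _ => le.
have -> : grad f xh = e - lam *: s.
  rewrite -[LHS]subr0 -step_first_order /e; apply/rowP => i.
  by rewrite !mxE; lra.
apply: le_trans (enormD _ _) _; rewrite enormN enormZ ger0_norm; last first.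
  by rewrite mulr_ge0 ?powR_ge0// divr_ge0// ltW.
have -> : lam * enorm s = sigma / (q + 1) * enorm s `^ (q + 1).
  by rewrite powRS// mulrA.
have e1 : sigma / (q + 1) * enorm s `^ (q + 1) <= 2 * L2 / (q + 1) * enorm s `^ (q + 1).
  case/andP: sigmaP => _ ?.
  by rewrite ler_wpM2r ?powR_ge0// ler_wpM2r ?invr_ge0// ltW.
lra.
Qed.

(** The first-order condition at the step and stationarity of z are tested
    against xh - z; positivity of the Hessian at z leaves an inequality that a
    step much longer than x - z would violate. *)
Lemma step_le_dist z : F z -> stationary2 f z ->
  enorm s <= 14 `^ q^-1 * enorm (x - z).
Proof.
move=> Fz [gz psdz].
have Fzx : F (z + (x - z)) by rewrite addrC subrK.
have := grad_taylor C2f q0 (ltW L20) (segment_holder Fz Fzx).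
rewrite [z + _]addrC subrK gz subr0.
set d := x - z; set e0 := _ - d *m _ => le0.
set D := enorm d; set r := enorm s.
have D0 : 0 <= D := enorm_ge0 _.
have M14 : (14 `^ q^-1 : R) `^ q = 14 by rewrite -powRrM mulVf ?gt_eqF// powRr1.
have qi1 : 1 <= q^-1 by rewrite invf_ge1//; case/andP: q01.
have M2 : 2 <= (14 `^ q^-1 : R).
  by apply: (@le_trans _ _ 14); rewrite ?le1r_powR ?ler1n// ler_nat.
set M := 14 `^ q^-1 in M14 M2 *; clearbody M.
have M0 : 0 <= M by apply: le_trans M2.
rewrite leNgt; apply/negP => rD.
have r0 : 0 < r by apply: le_lt_trans rD; rewrite mulr_ge0.
have rqD : 14 * D `^ q < r `^ q.
  have rge0 : 0 <= r := ltW r0.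
  rewrite -M14 -powRM//; apply: gt0_ltr_powR => //; rewrite nnegrE ?mulr_ge0//.
have r2D : 2 * D <= r.
  by apply: ltW; apply: le_lt_trans rD; rewrite ler_wpM2r.
set w := s + d.
have W : enorm w <= r + D by exact: enormD.
have eq0 : e0 + w *m hess f z + s *m (hess f x - hess f z) + lam *: s = 0.
  have wE : w *m hess f z = d *m hess f z + s *m hess f z.
    by rewrite /w addrC mulmxDl.
  have sE : s *m (hess f x - hess f z) = s *m hess f x - s *m hess f z.
    exact: mulmxBr.
  rewrite wE sE -step_first_order; exact: addr_regroup.
clearbody e0.
have : dot (e0 + w *m hess f z + s *m (hess f x - hess f z) + lam *: s) w = 0.
  by rewrite eq0 dot0l.
rewrite !dotDl dotZl => E.
have h1 := cauchy_schwarzN e0 w.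
have h2 := cauchy_schwarzN (s *m (hess f x - hess f z)) w.
have h3 := psdz w.
have h4 : enorm (s *m (hess f x - hess f z)) <= L2 * D `^ q * r.
  apply: le_trans (opnorm_ub _ _) _; rewrite ler_wpM2r ?enorm_ge0//.
  exact: Fholder.
have h5 : dot s w >= r ^+ 2 - r * D.
  rewrite /w dotDr -enorm_sqr lerD2l; exact: cauchy_schwarzN.
have h6 : enorm e0 <= L2 * D `^ q * D.
  apply: le_trans le0 _; rewrite powRS// -[leRHS]mulrA ler_wpM2r//.
    by rewrite mulr_ge0 ?powR_ge0.
  by rewrite ler_pdivrMr// ler_peMr ?(ltW L20)// lerDr ltW.
have w0 := enorm_ge0 w.
have Dq : 0 <= D `^ q := powR_ge0 _ _.
have lamr : L2 / 3 * r `^ q <= lam.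
  rewrite /lam -/r ler_wpM2r ?powR_ge0//.
  by rewrite ler_pdivlMr// (le_trans sbar_third)//; case/andP: sigmaP.
exact: (long_step_absurd L20 Dq rqD D0 r0 r2D lamr w0 W h6 h4 h1 h3 h2 h5 E).
Qed.

End OneStep.

End Step.

(** * Superlinear contraction traps a sequence *)

Section LocalConvergence.
Context {R : realType} {m : nat}.
Variables (x : nat -> 'rV[R]_m) (xbar : 'rV[R]_m) (d : nat -> R).
Variables (rho C A alpha : R) (N : nat).
Let e k := enorm (x k - xbar).
Hypothesis rho0 : 0 < rho.
Hypothesis C0 : 0 <= C.
Hypothesis A0 : 0 <= A.
Hypothesis alpha1 : 1 < alpha.
Hypothesis d_le : forall k, (N <= k)%N -> e k < rho -> 0 <= d k <= e k.
Hypothesis step_le : forall k, (N <= k)%N -> e k < rho ->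
  enorm (x k.+1 - x k) <= C * d k.
Hypothesis d_superlinear : forall k, (N <= k)%N -> e k < rho -> e k.+1 < rho ->
  d k.+1 <= A * d k `^ alpha.
Hypothesis frequently : forall (eps : R) n, 0 < eps ->
  exists2 k, (n <= k)%N & e k < eps.

(** An exponent greater than 1 wins against any constant near 0. *)
Lemma superlinear_halves : exists2 delta : R, 0 < delta &
  forall t, 0 <= t <= delta -> A * t `^ alpha <= t / 2.
Proof.
have A1 : 0 < A + 1 by rewrite ltr_wpDl.
have b0 : 0 < alpha - 1 by rewrite subr_gt0.
pose delta := ((2 * (A + 1))^-1 `^ (alpha - 1)^-1 : R).
have i0 : 0 < (2 * (A + 1))^-1 by rewrite invr_gt0 mulr_gt0.
exists delta; first exact: powR_gt0.
move=> t /andP[t0 td].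
have dE : delta `^ (alpha - 1) = (2 * (A + 1))^-1.
  by rewrite /delta -powRrM mulVf ?gt_eqF// powRr1// ltW.
have le : t `^ (alpha - 1) <= (2 * (A + 1))^-1.
  by rewrite -dE; apply: ge0_ler_powR; rewrite ?nnegrE ?powR_ge0// ltW.
have -> : t `^ alpha = t `^ (alpha - 1) * t by rewrite -powRS// subrK.
rewrite mulrA [leRHS]mulrC ler_wpM2r//.
apply: (le_trans (ler_wpM2l A0 le)).
by rewrite ler_pdivrMr ?mulr_gt0// mulrA mulVf// mul1r lerDl.
Qed.

(** The potential |x_j - x_k| + 2 C d_j does not increase with j: a step costs
    at most C d_j and the halving of d refunds that amount. *)
Lemma trapped : exists2 delta : R, 0 < delta &
  forall k j, (N <= k)%N -> e k < delta ->
    [/\ e (k + j)%N < rho, enorm (x (k + j)%N - x k) <= 2 * C * d k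
      & d (k + j)%N <= d k].
Proof.
have [delta delta0 half] := superlinear_halves.
have C1 : 0 < 1 + 2 * C by rewrite ltr_pwDl// mulr_ge0.
exists (Num.min delta (rho / (1 + 2 * C))); first by rewrite lt_min delta0 divr_gt0.
move=> k j Nk; rewrite lt_min => /andP[ed]; rewrite ltr_pdivlMr// => er.
have ek0 : 0 <= e k := enorm_ge0 _.
have ekr : e k < rho.
  by apply: le_lt_trans er; rewrite ler_peMr// lerDl mulr_ge0.
have /andP[dk0 dke] := d_le Nk ekr.
have near i : enorm (x (k + i)%N - x k) <= 2 * C * d k -> e (k + i)%N < rho.
  move=> h; apply: le_lt_trans er; rewrite /e -(subrKA (x k)).
  apply: le_trans (enormD _ _) _.
  have := ler_wpM2l (mulr_ge0 (ler0n R 2) C0) dke; rewrite /e in h * => h'.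
  rewrite mulrDr mulr1 addrC lerD2l mulrC; exact: le_trans h'.
suff [h1 h2 h3] : [/\ e (k + j)%N < rho,
    enorm (x (k + j)%N - x k) + 2 * C * d (k + j)%N <= 2 * C * d k
    & d (k + j)%N <= d k].
  split=> //; apply: le_trans h2; rewrite lerDl mulr_ge0 ?mulr_ge0//.
  by have /andP[] := d_le (leq_trans Nk (leq_addr j k)) h1.
elim: j => [|j [ej pj dj]]; first by rewrite addn0 subrr enorm0 add0r.
have Nj : (N <= k + j)%N := leq_trans Nk (leq_addr j k).
have /andP[dj0 _] := d_le Nj ej.
have move1 : enorm (x (k + j.+1)%N - x k) + C * d (k + j)%N <= 2 * C * d k.
  rewrite addnS -(subrKA (x (k + j)%N)).
  have := enormD (x (k + j).+1 - x (k + j)%N) (x (k + j)%N - x k).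
  have := step_le Nj ej; lra.
have ej1 : e (k + j.+1)%N < rho.
  by apply: near; apply: le_trans move1; rewrite lerDl mulr_ge0.
have dj1 : d (k + j.+1)%N <= d (k + j)%N / 2.
  rewrite addnS; apply: le_trans (d_superlinear Nj ej _) _; first by rewrite -addnS.
  by apply: half; rewrite dj0 (le_trans dj)// (le_trans dke)// ltW.
split => //; last by lra.
by apply: le_trans move1; rewrite lerD2l; have := ler_wpM2l C0 dj1; lra.
Qed.

Lemma local_convergence (eps : R) : 0 < eps ->
  exists n, forall k, (n <= k)%N -> e k < eps.
Proof.
move=> eps0; have [delta delta0 trap] := trapped.
have C1 : 0 < 1 + 2 * C by rewrite ltr_pwDl// mulr_ge0.
pose t := Num.min (Num.min delta rho) (eps / (1 + 2 * C)).
have t0 : 0 < t by rewrite !lt_min delta0 rho0 divr_gt0.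
have [k Nk] := frequently N t0; rewrite !lt_min => /andP[/andP[kd kr]].
rewrite ltr_pdivlMr// => ke.
exists k => j /subnKC <-; have [_ h _] := trap _ (j - k)%N Nk kd.
have /andP[_ dke] := d_le Nk kr.
apply: le_lt_trans ke; rewrite /e -(subrKA (x k)).
apply: le_trans (enormD _ _) _.
have := ler_wpM2l (mulr_ge0 (ler0n R 2) C0) dke; rewrite /e; lra.
Qed.

(** The whole path after x_(k+1) has length at most 2 C d_(k+1), so this also
    bounds the distance to the limit. *)
Lemma local_rate : exists B n, forall k, (n <= k)%N -> e k.+1 <= B * e k `^ alpha.
Proof.
have [delta delta0 trap] := trapped.
have min0 : 0 < Num.min delta rho by rewrite lt_min delta0 rho0.
have [n0 h0] := local_convergence min0.
exists (2 * C * A), (maxn N n0) => k; rewrite geq_max => /andP[Nk nk].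
have := h0 k nk; rewrite lt_min => /andP[kd kr].
have nk1 : (n0 <= k.+1)%N by exact: leq_trans (leqnSn k).
have Nk1 : (N <= k.+1)%N by exact: leq_trans (leqnSn k).
have := h0 k.+1 nk1; rewrite lt_min => /andP[k1d k1r].
have /andP[dk0 dke] := d_le Nk kr.
have dS := d_superlinear Nk kr k1r.
have le1 : e k.+1 <= 2 * C * d k.+1.
  apply/ler_addgt0Pr => eps eps0; have [j kj je] := frequently k.+1 eps0.
  have [_ h _] := trap k.+1 (j - k.+1)%N Nk1 k1d; rewrite subnKC// in h.
  rewrite /e -(subrKA (x j)); apply: le_trans (enormD _ _) _.
  by rewrite (enormB (x k.+1)); apply: lerD => //; exact: ltW.
apply: le_trans le1 _; rewrite -[leRHS]mulrA ler_wpM2l ?mulr_ge0//.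
apply: le_trans dS _; rewrite ler_wpM2l//.
by apply: ge0_ler_powR; rewrite ?nnegrE ?enorm_ge0// ltW// (lt_trans ltr01).
Qed.

End LocalConvergence.

(** * Distances, neighbourhoods and accumulation points *)

(** A zero denominator forces a zero numerator, and 0 / 0 counts as 0. *)
Lemma limn_esup_ratio_lty (R : realType) (u v : nat -> R) (B : R) (n : nat) :
  (forall k, 0 <= u k) -> (forall k, 0 <= v k) ->
  (forall k, (n <= k)%N -> u k <= B * v k) ->
  (limn_esup (fun k => (u k)%:E / (v k)%:E) < +oo)%E.
Proof.
move=> u0 v0 uv; apply: (@le_lt_trans _ _ `|B|%:E); last exact: ltry.
apply: (@le_trans _ _ (ereal_sup
    ((fun k => (u k)%:E / (v k)%:E)%E @` [set k | (n <= k)%N]))).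
  by apply: ereal_inf_lbound; exists [set k | (n <= k)%N] => //; exists n.
apply: ge_ereal_sup => _ [k /= nk <-]; have := uv k nk.
have [->|vk] := eqVneq (v k) 0.
  rewrite mulr0 => uk; have -> : u k = 0 by apply/eqP; rewrite eq_le uk u0.
  by rewrite mul0e lee_fin.
have vk0 : 0 < v k by rewrite lt_def vk v0.
move=> uk; rewrite inver (negbTE vk) -EFinM lee_fin ler_pdivrMr//.
by apply: le_trans uk _; rewrite ler_wpM2r// ler_norm.
Qed.

Section Distance.
Context {R : realType} {m : nat}.
Implicit Types (S : set 'rV[R]_m) (y z : 'rV[R]_m).

(** The infimum need not be attained, so it is used through almost nearest
    points. *)
Lemma edistanceP y z S : S z -> exists2 d : R, edistance y S = d%:E &
  [/\ 0 <= d, d <= enorm (y - z)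
    & forall eps, 0 < eps -> exists2 w, S w & enorm (y - w) < d + eps].
Proof.
move=> Sz.
have le : (edistance y S <= (enorm (y - z))%:E)%E.
  by apply: ereal_inf_lbound; exists z.
have ge : (0 <= edistance y S)%E.
  by apply: le_ereal_inf_tmp => _ [w _ <-]; rewrite lee_fin enorm_ge0.
have fin : edistance y S \is a fin_num.
  by rewrite ge0_fin_numE//; apply: le_lt_trans le _; exact: ltry.
exists (fine (edistance y S)); first by rewrite fineK.
split; first exact: fine_ge0.
  by rewrite -lee_fin fineK.
move=> eps eps0; have [_ [w Sw <-]] := lb_ereal_inf_adherent eps0 fin.
rewrite -/(edistance y S) -(fineK fin) -EFinD lte_fin => h.
by exists w.
Qed.

End Distance.

Lemma nbhs_enorm (R : realType) (m : nat) (x : 'rV[R]_m) (A : set 'rV[R]_m) :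
  nbhs x A <-> exists2 r : R, 0 < r & forall y, enorm (y - x) < r -> A y.
Proof.
split=> [/nbhs_normP[r /= r0 h]|[r r0 h]].
  exists r => // y yx; apply: h; rewrite /= /ball_/= distrC.
  exact: le_lt_trans (norm_le_enorm _) yx.
have m1 : 0 < (m.+1%:R : R) by rewrite ltr0n.
apply: (nbhs_normP x A).2; exists (r / m.+1%:R) => /=; first exact: divr_gt0.
move=> y /=; rewrite distrC ltr_pdivlMr// => yx; apply: h.
apply: le_lt_trans (enorm_le_norm _) _; apply: le_lt_trans yx.
by rewrite mulrC ler_wpM2l// ler_nat.
Qed.

Section AccumulationPoints.
Context {R : realType} {m : nat}.
Variables (x : nat -> 'rV[R]_m) (xbar : 'rV[R]_m).
Hypothesis hacc : cluster (x @ \oo) xbar.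

Lemma cluster_frequently (eps : R) n : 0 < eps ->
  exists2 k, (n <= k)%N & enorm (x k - xbar) < eps.
Proof.
move=> eps0.
have nA : (x @ \oo) [set x k | k in [set k | (n <= k)%N]].
  by exists n => // k /= nk; exists k.
have nB : nbhs xbar [set y | enorm (y - xbar) < eps].
  by apply/nbhs_enorm; exists eps.
by have [_ [[k /= nk <-] kB]] := hacc nA nB; exists k.
Qed.

Lemma cluster_closed (A : set 'rV[R]_m) : closed A -> (forall k, A (x k)) -> A xbar.
Proof.
move=> cA Ax; apply: cA => B nB; apply: hacc => //.
by exists 0%N => // k _; exact: Ax.
Qed.

End AccumulationPoints.

(** * Convergence of the algorithm *)

Lemma psd_arith (R : realFieldType) (L A B o n s t eps : R) :
  - (2 * L * s * n ^+ 2) <= A -> A - B <= o * n * n ->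
  o * (n * n) <= L * t * (n * n) -> L * s * (n * n) <= L * t * (n * n) ->
  t * (3 * L * n ^+ 2 + 1) = eps -> 0 <= t -> 0 <= B + eps.
Proof. by move=> *; lra. Qed.

Section Algorithm.
Context {R : realType} {m : nat}.
Variables (f : 'rV[R]_m -> R) (F : set 'rV[R]_m) (L1 L2 q sigmabar zeta : R).
Variables (sigma : nat -> R) (x xhat : nat -> 'rV[R]_m).
Hypothesis C2f : C2 f.
Hypothesis finf : (-oo < ereal_inf [set (f y)%:E | y in setT])%E.
Hypothesis L10 : 0 < L1.
Hypothesis q01 : 0 < q <= 1.
Hypothesis L20 : 0 < L2.
Hypothesis Fcl : closed F.
Hypothesis Fcvx : convex_set (F : set (convex_lmodType 'rV[R]_m)).
Hypothesis subF : sublevel f (f (x 0%N)) `<=` F°.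
Hypothesis Flip : forall y z, F y -> F z ->
  enorm (grad f y - grad f z) <= L1 * enorm (y - z).
Hypothesis Fholder : forall y z, F y -> F z ->
  opnorm (hess f y - hess f z) <= L2 * enorm (y - z) `^ q.
Hypothesis halg : algorithm1 f L2 q sigmabar zeta sigma x xhat.

Let q0 : 0 < q. Proof. by case/andP: q01. Qed.
Let q1 : 0 < q + 1. Proof. by rewrite addr_gt0. Qed.
Let q2 : 0 < q + 2. Proof. by rewrite addr_gt0. Qed.

Let r k := enorm (xhat k.+1 - x k).
Let kappa := decrease_rate L2 q sigmabar.
Let kappa0 : 0 < kappa := decrease_rate_gt0 q01 (alg_sigmabar halg).

Let r0 k : 0 <= r k. Proof. exact: enorm_ge0. Qed.

Lemma select_le k : f (x k.+1) <= f (xhat k.+1).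
Proof. by have [_] := alg_select halg k; apply; left. Qed.

Lemma iterate_sublevel k : f (x k) <= f (x 0%N).
Proof.
elim: k => // k IH; apply: le_trans (select_le k) _.
have h := step_decrease C2f q01 L20 Fcl Fcvx subF Fholder (alg_sigmabar halg) IH
  (alg_sigma halg k) (alg_newton halg k).
apply: le_trans h _; apply: le_trans IH.
by rewrite gerBl mulr_ge0 ?powR_ge0// ltW.
Qed.

Lemma newton_decrease k : f (xhat k.+1) <= f (x k) - kappa * r k `^ (q + 2).
Proof.
exact: (step_decrease C2f q01 L20 Fcl Fcvx subF Fholder (alg_sigmabar halg)
  (iterate_sublevel k) (alg_sigma halg k) (alg_newton halg k)).
Qed.

Lemma newton_F k : F (xhat k.+1).
Proof.
exact: (step_inF C2f q01 L20 Fcl Fcvx subF Fholder (alg_sigmabar halg)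
  (iterate_sublevel k) (alg_sigma halg k) (alg_newton halg k)).
Qed.

Lemma newton_grad k :
  enorm (grad f (xhat k.+1)) <= 3 * L2 / (q + 1) * r k `^ (q + 1).
Proof.
exact: (step_grad C2f q01 L20 Fcl Fcvx subF Fholder (alg_sigmabar halg)
  (iterate_sublevel k) (alg_sigma halg k) (alg_newton halg k)).
Qed.

Lemma newton_le_dist k z : F z -> stationary2 f z ->
  r k <= 14 `^ q^-1 * enorm (x k - z).
Proof.
exact: (step_le_dist C2f q01 L20 Fcvx subF Fholder (alg_sigmabar halg)
  (iterate_sublevel k) (alg_sigma halg k) (alg_newton halg k)).
Qed.

Lemma newton_second_order k u :
  - (2 * L2 * r k `^ q * enorm u ^+ 2) <= dot (u *m hess f (x k)) u.
Proof.
apply: le_trans (step_second_order C2f q01 L20 (alg_sigmabar halg)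
  (alg_sigma halg k) (alg_newton halg k) u).
rewrite lerN2 ler_wpM2r ?sqr_ge0// ler_wpM2r ?powR_ge0//.
have /andP[_ s2] := alg_sigma halg k.
by rewrite ler_pdivrMr// (le_trans s2)// ler_peMr ?mulr_ge0 ?(ltW L20)// lerDr ltW.
Qed.

Lemma iterate_F k : F (x k).
Proof. exact: (sublevelF subF (iterate_sublevel k)). Qed.

Lemma iterate_nonincreasing k j : (k <= j)%N -> f (x j) <= f (x k).
Proof.
move=> /subnKC <-; elim: (j - k)%N => [|i IH]; first by rewrite addn0.
rewrite addnS; apply: le_trans (select_le _) _; apply: le_trans (newton_decrease _) _.
apply: le_trans IH; rewrite gerBl mulr_ge0 ?powR_ge0//; exact: ltW.
Qed.

(** The values f(x_k) decrease to a finite limit, and each decrease pays for a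
    power of the step. *)
Lemma step_cvg0 (eps : R) : 0 < eps -> exists n, forall k, (n <= k)%N -> r k < eps.
Proof.
move=> eps0.
have ni : nonincreasing_seq (fun k => f (x k)).
  by move=> j k; exact: iterate_nonincreasing.
have lb : has_lbound (range (fun k => f (x k))).
  have [M hM] : exists M : R, (M%:E <= ereal_inf [set (f y)%:E | y in setT])%E.
    move: finf; case: (ereal_inf _) => [M| |]// _; first by exists M.
    by exists 0; rewrite leey.
  exists M => _ [k _ <-]; rewrite -lee_fin; apply: le_trans hM _.
  by apply: ereal_inf_lbound; exists (x k).
have cv := nonincreasing_cvgn ni lb.
pose e' := kappa * eps `^ (q + 2).
have e'0 : 0 < e' by rewrite mulr_gt0// powR_gt0.
have e20 : 0 < e' / 2 by rewrite divr_gt0.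
have /cvgrPdist_lt/(_ _ e20)[n _ hn] := cv.
exists n => k nk.
have nk1 : (n <= k.+1)%N by exact: leq_trans (leqnSn k).
have h1 := hn k nk; have h2 := hn k.+1 nk1; rewrite /= in h1 h2.
have h3 := select_le k; have h4 := newton_decrease k.
rewrite ltNge; apply/negP => epsr.
have h5 : e' <= kappa * r k `^ (q + 2).
  rewrite ler_wpM2l ?(ltW kappa0)//; apply: ge0_ler_powR; rewrite ?nnegrE ?(ltW q2)//.
  exact: ltW.
move: h1 h2; rewrite !ltr_norml => /andP[h1 h1'] /andP[h2 h2']; lra.
Qed.

Section Bounded.
Variable k0 : nat.
Hypothesis hbnd : bounded_set (sublevel f (f (x k0))).

Lemma momentum_bounded : exists2 B : R, 0 <= B &
  forall k, (k0 < k)%N -> enorm (xhat k.+1 - xhat k) <= B.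
Proof.
have [M [_ hM]] := hbnd.
have bnd k : (k0 <= k)%N -> enorm (xhat k.+1) <= m%:R * (M + 1).
  move=> kk; apply: le_trans (enorm_le_norm _) _; rewrite ler_wpM2l//.
  apply: (hM (M + 1)); first by rewrite ltrDl.
  apply: le_trans (newton_decrease k) _.
  apply: le_trans (iterate_nonincreasing kk).
  by rewrite gerBl mulr_ge0 ?powR_ge0// ltW.
exists (2 * (m%:R * (M + 1))).
  by rewrite mulr_ge0// (le_trans _ (bnd k0 (leqnn _)))// enorm_ge0.
case=> // k kk; apply: le_trans (enormD _ _) _; rewrite enormN.
have := bnd k kk; have := bnd k.+1 (leq_trans kk (leqnSn _)); lra.
Qed.

(** Both the gradient and the step bound the extrapolation weight: the first
    keeps the gradient at x_(k+1) of order r_k^(q + 1), the second keeps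
    x_(k+1) - x_k of order r_k. *)
Lemma extrapolation_le (B : R) k : 0 <= B -> enorm (xhat k.+1 - xhat k) <= B ->
  enorm (x k.+1 - xhat k.+1) <= B * enorm (grad f (xhat k.+1)) /\
  enorm (x k.+1 - xhat k.+1) <= B * r k.
Proof.
move=> B0 hB; have [+ _] := alg_select halg k.
set beta := Num.min _ _.
have b0 : 0 <= beta by rewrite !le_min !enorm_ge0 !andbT; case/andP: (alg_zeta halg).
have b1 : beta <= enorm (grad f (xhat k.+1)) by rewrite !ge_min lexx orbT.
have b2 : beta <= r k by rewrite !ge_min lexx !orbT.
case=> ->.
  by rewrite subrr enorm0 !mulr_ge0 ?enorm_ge0.
rewrite addrC addKr enormZ ger0_norm// ![B * _]mulrC.
by split; apply: ler_pM => //; exact: enorm_ge0.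
Qed.

Lemma iterate_grad : exists2 G : R, 0 <= G &
  forall k, (k0 < k)%N -> enorm (grad f (x k.+1)) <= G * r k `^ (q + 1).
Proof.
have [B B0 hB] := momentum_bounded.
exists ((1 + L1 * B) * (3 * L2 / (q + 1))).
  apply: mulr_ge0; first by rewrite addr_ge0// mulr_ge0// ltW.
  by apply: divr_ge0; [rewrite mulr_ge0// ltW | exact: ltW q1].
move=> k kk; have [h _] := extrapolation_le B0 (hB k kk).
rewrite -[grad f _](subrK (grad f (xhat k.+1))).
apply: le_trans (enormD _ _) _.
have h1 := Flip (iterate_F k.+1) (newton_F k).
have h2 := ler_wpM2l (ltW L10) h.
have LB : 0 <= 1 + L1 * B by rewrite addr_ge0// mulr_ge0// ltW.
have h3 := ler_wpM2l LB (newton_grad k).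
rewrite -mulrA; apply: le_trans h3; lra.
Qed.

Lemma iterate_step : exists2 K : R, 0 <= K &
  forall k, (k0 < k)%N -> enorm (x k.+1 - x k) <= K * r k.
Proof.
have [B B0 hB] := momentum_bounded.
exists (1 + B); first by rewrite addr_ge0.
move=> k kk; have [_ h] := extrapolation_le B0 (hB k kk).
rewrite -(subrKA (xhat k.+1)); apply: le_trans (enormD _ _) _.
rewrite -/(r k); lra.
Qed.

Variable xbar : 'rV[R]_m.
Hypothesis hacc : cluster (x @ \oo) xbar.

Let e k := enorm (x k - xbar).

(** Being in the interior of F, and not only in F, makes nearby stationary
    points available for step_le_dist. *)
Lemma cluster_intF : F° xbar.
Proof.
apply: subF; apply: (cluster_closed hacc); last exact: iterate_sublevel.
have [df _ _] := C2f.
apply: (@preimage_closed _ _ f [set y | y <= f (x 0%N)]); last exact: closed_le.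
by move=> y _; exact: differentiable_continuous.
Qed.

Let Fbar : F xbar. Proof. exact: interior_subset cluster_intF. Qed.

(** Such iterates carry the approximate first- and second-order conditions of the
    model over to xbar. *)
Lemma cluster_small_steps (eps : R) n : 0 < eps ->
  exists k, [/\ (n <= k)%N, r k < eps & e k < eps].
Proof.
move=> eps0; have [n1 h1] := step_cvg0 eps0.
have [k] := cluster_frequently hacc (maxn n n1) eps0.
by rewrite geq_max => /andP[nk n1k] ek; exists k; split=> //; exact: h1.
Qed.

Lemma cluster_grad0 : grad f xbar = 0.
Proof.
have [G G0 hG] := iterate_grad; have [K K0 hK] := iterate_step.
apply: enorm_eq0; apply/eqP; rewrite eq_le enorm_ge0 andbT.
have C0 : 0 < G + L1 * (K + 1) + 1.
  by rewrite ltr_wpDl// addr_ge0// mulr_ge0 ?addr_ge0// ltW.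
apply/ler_addgt0Pr => eps eps0; rewrite add0r.
pose t := Num.min 1 (eps / (G + L1 * (K + 1) + 1)).
have t0 : 0 < t by rewrite lt_min ltr01 divr_gt0.
have t1 : t <= 1 by rewrite ge_min lexx.
have tE : t * (G + L1 * (K + 1) + 1) <= eps by rewrite -ler_pdivlMr// ge_min lexx orbT.
have [k [kk rk ek]] := cluster_small_steps k0.+1 t0.
have rq : r k `^ (q + 1) <= t.
  rewrite powRS// -[leRHS]mul1r.
  apply: ler_pM; [exact: powR_ge0|exact: r0| |exact: ltW].
  have E1 : (1 : R) `^ q = 1 by rewrite powR1.
  rewrite -[leRHS]E1; apply: ge0_ler_powR; rewrite ?nnegrE ?(ltW q0)//.
  by apply: le_trans t1; exact: ltW.
have h1 := le_trans (hG k kk) (ler_wpM2l G0 rq).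
have h2 := Flip Fbar (iterate_F k.+1).
have h3 : enorm (xbar - x k.+1) <= (K + 1) * t.
  rewrite enormB -(subrKA (x k)); apply: le_trans (enormD _ _) _.
  have := le_trans (hK k kk) (ler_wpM2l K0 (ltW rk)); rewrite /e in ek; lra.
have h4 := le_trans h2 (ler_wpM2l (ltW L10) h3).
rewrite -[grad f xbar](subrK (grad f (x k.+1))); apply: le_trans (enormD _ _) _.
apply: le_trans tE; lra.
Qed.

Lemma cluster_psd : psd (hess f xbar).
Proof.
move=> v; apply/ler_addgt0Pr => eps eps0.
have C0 : 0 < 3 * L2 * enorm v ^+ 2 + 1.
  by rewrite ltr_wpDl// mulr_ge0 ?sqr_ge0// mulr_ge0// ltW.
pose t := eps / (3 * L2 * enorm v ^+ 2 + 1).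
have t0 : 0 < t by rewrite divr_gt0.
have tE : t * (3 * L2 * enorm v ^+ 2 + 1) = eps by rewrite divfK// gt_eqF.
clearbody t.
have [k [_ rk ek]] := cluster_small_steps 0 (powR_gt0 q^-1 t0).
have tq : (t `^ q^-1) `^ q = t by rewrite -powRrM mulVf ?gt_eqF// powRr1// ltW.
have rq : r k `^ q <= t.
  by rewrite -[leRHS]tq; apply: ge0_ler_powR; rewrite ?nnegrE ?powR_ge0 ?(ltW q0)// ltW.
have ekq : e k `^ q <= t.
  rewrite -[leRHS]tq; apply: ge0_ler_powR; rewrite ?nnegrE ?powR_ge0 ?(ltW q0) ?enorm_ge0//.
  exact: ltW.
have h1 := newton_second_order k v.
have h2 := Fholder (iterate_F k) Fbar; rewrite -/(e k) in h2.
have h3 := dot_mulmx_le v v (hess f (x k) - hess f xbar).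
rewrite mulmxBr dotBl in h3.
have n0 : 0 <= enorm v * enorm v by rewrite mulr_ge0 ?enorm_ge0.
have h4 := ler_wpM2r n0 (le_trans h2 (ler_wpM2l (ltW L20) ekq)).
have h5 := ler_wpM2r n0 (ler_wpM2l (ltW L20) rq).
exact: (psd_arith h1 h3 h4 h5 tE (ltW t0)).
Qed.

Lemma cluster_stationary2 : stationary2 f xbar.
Proof. by split; [exact: cluster_grad0|exact: cluster_psd]. Qed.

Section ErrorBound.
Variables (p c eta : R).
Hypothesis hp : 0 < p.
Hypothesis hc : 0 < c.
Hypothesis heta : 0 < eta.
Hypothesis herr : forall y, enorm (y - xbar) < eta ->
  (edistance y (stationary2 f) `^ p <= (c * enorm (grad f y))%:E)%E.
Hypothesis hpq : p < q + 1.

Let d k := fine (edistance (x k) (stationary2 f)).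

Let dP k : edistance (x k) (stationary2 f) = (d k)%:E /\ [/\ 0 <= d k, d k <= e k
  & forall eps, 0 < eps -> exists2 w, stationary2 f w & enorm (x k - w) < d k + eps].
Proof.
have [t E P] := edistanceP (x k) cluster_stationary2.
by rewrite /d E.
Qed.

(** Almost nearest second-order stationary points lie in F once x_k is close to
    xbar; step_le_dist applies to them, and the error tends to 0. *)
Lemma step_le_distance : exists2 rho : R, 0 < rho &
  forall k, e k < rho -> r k <= 14 `^ q^-1 * d k.
Proof.
have /nbhs_enorm[rho rho0 hF] : nbhs xbar F by exact: cluster_intF.
exists (rho / 3); first by rewrite divr_gt0.
move=> k ek; have [_ [d0 de proj]] := dP k.
set M := 14 `^ q^-1; have M0 : 0 <= M by exact: powR_ge0.
rewrite -subr_ge0.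
apply: (@ge0_of_small_slope _ _ M (rho / 3)); first by rewrite divr_gt0.
move=> eps /andP[eps0 epsr]; have [w Sw hw] := proj _ eps0.
have Fw : F w.
  apply: hF; rewrite -(subrKA (x k)); apply: le_lt_trans (enormD _ _) _.
  rewrite enormB; rewrite /e in ek de; lra.
have h := newton_le_dist k Fw Sw.
have := ler_wpM2l M0 (ltW hw); rewrite -/M in h; lra.
Qed.

(** The error bound at x_(k+1) closes the loop: distance, gradient, step, and
    distance again. *)
Lemma distance_superlinear : exists rho A : R, [/\ 0 < rho, 0 <= A &
  forall k, (k0 < k)%N -> e k < rho -> e k.+1 < rho ->
    d k.+1 <= A * d k `^ ((q + 1) / p)].
Proof.
have [rho rho0 hr] := step_le_distance; have [G G0 hG] := iterate_grad.
pose M : R := 14 `^ q^-1; have M0 : 0 <= M by exact: powR_ge0.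
pose A := c * (G * M `^ (q + 1)).
have A0 : 0 <= A by rewrite mulr_ge0 ?(ltW hc)// mulr_ge0 ?powR_ge0.
exists (Num.min rho eta), (A `^ p^-1); split; first by rewrite lt_min rho0.
  exact: powR_ge0.
move=> k kk; rewrite !lt_min => /andP[ek _] /andP[_ ek1].
have [E1 [d10 _ _]] := dP k.+1; have [_ [dk0 _ _]] := dP k.
have := herr ek1; rewrite E1 poweR_EFin lee_fin => h1.
have h2 : r k `^ (q + 1) <= M `^ (q + 1) * d k `^ (q + 1).
  rewrite -powRM//; apply: ge0_ler_powR; rewrite ?nnegrE ?mulr_ge0 ?(ltW q1)//.
  exact: hr.
have h3 : d k.+1 `^ p <= A * d k `^ (q + 1).
  apply: (le_trans h1); rewrite /A -mulrA ler_wpM2l ?(ltW hc)//.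
  by apply: le_trans (hG k kk) _; rewrite -mulrA ler_wpM2l.
have -> : d k.+1 = (d k.+1 `^ p) `^ p^-1 by rewrite -powRrM mulfV ?gt_eqF// powRr1.
rewrite powRrM -powRM ?powR_ge0//; apply: ge0_ler_powR => //.
- by rewrite invr_ge0 ltW.
- by rewrite nnegrE powR_ge0.
- by rewrite nnegrE mulr_ge0 ?powR_ge0.
Qed.

Lemma algorithm_convergence :
  (forall eps, 0 < eps -> exists n, forall k, (n <= k)%N -> e k < eps) /\
  exists B n, forall k, (n <= k)%N -> e k.+1 <= B * e k `^ ((q + 1) / p).
Proof.
have [rho1 rho10 hr] := step_le_distance.
have [rho2 [A [rho20 A0 hd]]] := distance_superlinear.
have [K K0 hK] := iterate_step.
pose M : R := 14 `^ q^-1; have M0 : 0 <= M by exact: powR_ge0.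
pose rho := Num.min rho1 rho2.
have rho0 : 0 < rho by rewrite lt_min rho10.
have KM0 : 0 <= K * M by exact: mulr_ge0.
have alpha1 : 1 < (q + 1) / p by rewrite ltr_pdivlMr// mul1r.
have d_le k : (k0.+1 <= k)%N -> e k < rho -> 0 <= d k <= e k.
  by move=> _ _; have [_ [-> -> _]] := dP k.
have step_le k : (k0.+1 <= k)%N -> e k < rho -> enorm (x k.+1 - x k) <= K * M * d k.
  move=> kk; rewrite lt_min => /andP[ek _]; apply: le_trans (hK k kk) _.
  by rewrite -mulrA ler_wpM2l// hr.
have d_sup k : (k0.+1 <= k)%N -> e k < rho -> e k.+1 < rho ->
    d k.+1 <= A * d k `^ ((q + 1) / p).
  by move=> kk; rewrite !lt_min => /andP[_ ek] /andP[_ ek1]; exact: hd.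
have freq := cluster_frequently hacc.
split; first exact: (local_convergence rho0 KM0 A0 alpha1 d_le step_le d_sup freq).
exact: (local_rate rho0 KM0 A0 alpha1 d_le step_le d_sup freq).
Qed.

End ErrorBound.
End Bounded.
End Algorithm.

(* The quotient in the limsup is taken in the extended reals, where
   0 / 0 = 0 and a / 0 = +oo for a > 0. *)
Theorem corollary7p8 (R : realType) (m : nat) (f : 'rV[R]_m -> R)
    (L1 L2 q sigmabar zeta : R) (sigma : nat -> R)
    (x xhat : nat -> 'rV[R]_m) (k0 : nat) (xbar : 'rV[R]_m) (p c eta : R)
    (hA : assumptionA f (x 0%N) L1 L2 q)
    (halg : algorithm1 f L2 q sigmabar zeta sigma x xhat)
    (hbnd : bounded_set (sublevel f (f (x k0))))
    (hacc : cluster (x @ \oo) xbar)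
    (hp : 0 < p) (hc : 0 < c) (heta : 0 < eta)
    (herr : forall y, enorm (y - xbar) < eta ->
      (edistance y (stationary2 f) `^ p <= (c * enorm (grad f y))%:E)%E)
    (hpq : p < q + 1) :
  [/\ stationary2 f xbar,
      x @ \oo --> xbar
    & (limn_esup (fun k => (enorm (x k.+1 - xbar))%:E
         / (enorm (x k - xbar) `^ ((q + 1) / p))%:E) < +oo)%E].
Proof.
have [C2f finf L10 [L20 q01] [F [[Fcl Fcvx _] _ subF Flip Fholder]]] := hA.
have [cvx [B [n rate]]] := algorithm_convergence C2f finf L10 q01 L20 Fcl Fcvx subF
  Flip Fholder halg hbnd hacc hp hc heta herr hpq.
split.
- exact: (cluster_stationary2 C2f finf L10 q01 L20 Fcl Fcvx subF Flip Fholder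
    halg hbnd hacc).
- move=> A /nbhs_enorm[t t0 hA'].
  have [n1 hn1] := cvx t t0; exists n1 => // k /= nk.
  by apply: hA'; exact: hn1.
- apply: (@limn_esup_ratio_lty _ _ _ B n) => // k; first exact: enorm_ge0.
  exact: powR_ge0.
Qed.
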